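(* Let $E$ and $F$ be Banach lattices. Then $K^r_{AM-un}(E,F)$ is an AL-space under the norm $\|\cdot\|_{AM-un}$ if and only if $E$ is an AM-space and $F$ is an AL-space.
   Context: For $x\in E_+$, $[-x,x]=\{y\in E:-x\le y\le x\}$. A net $(y_\alpha)$ in $F$ is un-convergent to $y\in F$ if $\||y_\alpha-y|\wedge u\|\to 0$ for every $u\in F_+$. A continuous linear operator $T:E\to F$ is AM-un-compact if for every $x\in E_+$ the bounded set $T[-x,x]$ is un-compact, meaning that every net in $T[-x,x]$ has a subnet that is un-convergent in $F$. $K_{AM-un}(E,F)$ is the set of AM-un-compact operators $E\to F$; operators are ordered by $S\le T$ iff $Sx\le Tx$ for all $x\in E_+$, and $K^+_{AM-un}(E,F)$ is the set of positive elements of $K_{AM-un}(E,F)$. Let $$K^r_{AM-un}(E,F)=\{T\in K_{AM-un}(E,F): \pm T\le S \text{ for some } S\in K^+_{AM-un}(E,F)\}$$ with the induced order. For $T\in K^r_{AM-un}(E,F)$ the AM-un-norm is $$\|T\|_{AM-un}=\inf\{\|S\|: S\in K^+_{AM-un}(E,F),\ S\ge \pm T\},$$ where $\|S\|$ is the operator norm. A Banach lattice $X$ is an AL-space if $\|x+y\|=\|x\|+\|y\|$ for all $x,y\in X_+$, and an AM-space if $\|x\vee y\|=\max\{\|x\|,\|y\|\}$ for all $x,y\in X_+$.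
   Formalization: The Banach lattices E and F are assumed nonzero; if E = 0 (or F = 0) then K^r_{AM-un}(E,F) = {0} is trivially an AL-space while the other lattice is arbitrary, so the equivalence as written fails. *)

(* Defs.v *)
From HB Require Import structures.
From mathcomp Require Import all_boot all_order all_algebra.
From mathcomp Require Import all_classical all_reals all_analysis.

Set Implicit Arguments.
Unset Strict Implicit.
Unset Printing Implicit Defensive.

Import Order.TTheory GRing.Theory Num.Theory.
Import numFieldNormedType.Exports.

Local Open Scope classical_set_scope.
Local Open Scope ring_scope.

Reserved Notation "x <=v y" (at level 70, y at next level).
Reserved Notation "x \vee y" (at level 50, left associativity).
Reserved Notation "x \wedge y" (at level 48, left associativity).

(* Real Banach lattices. The vector order and the lattice operations are fields
   of the mixin, rather than inherited from Order.Lattice, because the hierarchy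
   of ordered rings leaves no room for a join of Order.POrder and NormedModule.
   The notation `|x| is the norm of x; the modulus x \vee - x of the lattice is
   called [modulus] below. *)
HB.mixin Record isBanachLattice (R : realType) V
    of CompleteNormedModule R V := {
  vle : V -> V -> Prop ;
  vjoin : V -> V -> V ;
  vmeet : V -> V -> V ;
  vle_refl : forall x, vle x x ;
  vle_anti : forall x y, vle x y -> vle y x -> x = y ;
  vle_trans : forall y x z, vle x y -> vle y z -> vle x z ;
  vle_joinP : forall x y z, vle (vjoin x y) z <-> vle x z /\ vle y z ;
  vle_meetP : forall x y z, vle z (vmeet x y) <-> vle z x /\ vle z y ;
  vle_add2r : forall z x y, vle x y -> vle (x + z) (y + z) ;
  vle_scale_ge0 : forall (a : R) x, 0 <= a -> vle 0 x -> vle 0 (a *: x) ;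
  vnorm_solid : forall x y,
    vle (vjoin x (- x)) (vjoin y (- y)) -> `|x| <= `|y|
}.

#[short(type="banachLatticeType")]
HB.structure Definition BanachLattice (R : realType) :=
  {V of CompleteNormedModule R V & isBanachLattice R V}.

Notation "x <=v y" := (vle x y) : ring_scope.
Notation "x \vee y" := (vjoin x y) : ring_scope.
Notation "x \wedge y" := (vmeet x y) : ring_scope.

Definition modulus (R : realType) (X : banachLatticeType R) (x : X) : X :=
  x \vee - x.

Definition is_AL_space (R : realType) (X : banachLatticeType R) : Prop :=
  forall x y : X, 0 <=v x -> 0 <=v y -> `|x + y| = `|x| + `|y|.

Definition is_AM_space (R : realType) (X : banachLatticeType R) : Prop :=
  forall x y : X, 0 <=v x -> 0 <=v y -> `|x \vee y| = Num.max `|x| `|y|.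

(* The subset D of V, with the vector space operations of V, the order le and
   the norm nrm, is an AL-space: it is the carrier of a Banach lattice X, seen
   inside V through the embedding iota, which is an AL-space. *)
Definition is_AL_space_under (R : realType) (V : lmodType R) (D : set V)
    (le : V -> V -> Prop) (nrm : V -> R) : Prop :=
  exists (X : banachLatticeType R) (iota : {linear X -> V}),
    [/\ injective iota,
        range iota = D,
        forall x y : X, x <=v y <-> le (iota x) (iota y),
        forall x : X, `|x| = nrm (iota x)
      & is_AL_space X].

Record directed (I : Type) (le : I -> I -> Prop) : Prop := Directed {
  directed_inhabited : inhabited I ;
  directed_refl : forall i, le i i ;
  directed_trans : forall i j k, le i j -> le j k -> le i k ;
  directed_ub : forall i j, exists k, le i k /\ le j k
}.

Definition tails (I : Type) (le : I -> I -> Prop) : set_system I :=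
  [set A | exists i0, forall i, le i0 i -> A i].

(* phi : J -> I presents the subnet y \o phi of a net y indexed by I
   (subnets in the sense of Kelley: phi is final, not necessarily monotone). *)
Definition subnet_index (I J : Type) (leI : I -> I -> Prop)
    (leJ : J -> J -> Prop) (phi : J -> I) : Prop :=
  forall i0, exists j0, forall j, leJ j0 j -> leI i0 (phi j).

Definition un_cvg (R : realType) (F : banachLatticeType R) (I : Type)
    (le : I -> I -> Prop) (y : I -> F) (l : F) : Prop :=
  forall u : F, 0 <=v u ->
    (fun i => `|modulus (y i - l) \wedge u|) @ tails le --> (0 : R).

(* The un-limit is required to exist in F, not necessarily in A. *)
Definition un_compact (R : realType) (F : banachLatticeType R)
    (A : set F) : Prop :=
  forall (I : Type) (leI : I -> I -> Prop) (y : I -> F),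
    directed leI -> (forall i, A (y i)) ->
    exists (J : Type) (leJ : J -> J -> Prop) (phi : J -> I) (l : F),
      [/\ directed leJ, subnet_index leI leJ phi & un_cvg leJ (y \o phi) l].

Section AMun.
Context (R : realType) (E F : banachLatticeType R).
Implicit Types S T : E -> F.

Definition order_interval (x : E) : set E := [set y | - x <=v y /\ y <=v x].

Definition op_le S T : Prop := forall x : E, 0 <=v x -> S x <=v T x.

Definition op_norm T : R := sup [set `|T x| | x in [set x : E | `|x| <= 1]].

Definition K_AMun : set (E -> F) :=
  [set T | [/\ linear T, continuous T
             & forall x : E, 0 <=v x -> un_compact (T @` order_interval x)]].

Definition Kpos_AMun : set (E -> F) := [set T | K_AMun T /\ op_le 0 T].

Definition AMun_dominants T : set (E -> F) :=
  [set S | [/\ Kpos_AMun S, op_le T S & op_le (- T) S]].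

Definition Kr_AMun : set (E -> F) :=
  [set T | K_AMun T /\ exists S, AMun_dominants T S].

Definition AMun_norm T : R := inf [set op_norm S | S in AMun_dominants T].

End AMun.

Arguments Kr_AMun {R} E F.
Arguments K_AMun {R} E F.
Arguments Kpos_AMun {R} E F.

(* Main.v *)
From HB Require Import structures.
Require Import Defs.
From mathcomp Require Import all_boot all_order all_algebra.
From mathcomp Require Import all_classical all_reals all_analysis.
From mathcomp Require Import lra.

(** Suppose first that [E] is an AM-space and [F] an AL-space.  A regular operator
    sends order intervals to order bounded sets, where un-compactness is total
    boundedness for the norm ([dominated_K_AMun]).  As increasing norm bounded
    nets of an AL-space converge ([AL_directed_sup]), the Riesz-Kantorovich
    formula
      T^+ x = sup { (T x1)^+ + ... + (T xn)^+ | x = x1 + ... + xn, 0 <= xi }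
    defines a positive part ([riesz_kantorovich]), and the supremum is a norm
    limit.  The point is that [T^+] inherits compactness.  For [y >= 0] the
    defect [T^+ y - (T y)^+] is the infimum of [T^+ y] and [T^- y], hence
    nondecreasing in [y].  So if a partition of [x] nearly attains [T^+ x], then
    for every [0 <= y <= x], cut into [y1 + ... + yn] along that partition, the sum
    of the [(T yi)^+] is as close to [T^+ y]; these sums range over a totally
    bounded set, since [z |-> z^+] is a contraction ([pos_part_near_sum],
    [AMcompact_pos_part]).  Thus the regular operators form a vector lattice, and
    the norm of [T] is the operator norm of [|T|].  A fast Cauchy sequence [T n]
    has a pointwise limit, whose distance to [T n] is dominated by the tails of
    the series of the [|T n.+1 - T n|] ([regular_fast_cauchy]).  The norm is
    additive on positive operators because the supremum of two elements of the
    unit ball of an AM-space stays in the ball, and the norm of [F] is additive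
    ([op_norm_AL]).

    Conversely, rank one operators [x |-> phi x *: y] with [phi, y >= 0] belong to
    the space.  With [phi] fixed of norm one they embed [F] isometrically, so [F]
    is an AL-space ([AL_under_codomain]).  With [y] fixed they make the norm
    additive on positive functionals of [E]; Hahn-Banach on [E * E] writes
    [|x \/ y|] as [phi1 x + phi2 y] with [phi1, phi2 >= 0] and
    [|phi1 + phi2| <= 1], which gives [|x \/ y| <= max(|x|, |y|)]
    ([AL_under_domain]). *)

Set Implicit Arguments.
Unset Strict Implicit.
Unset Printing Implicit Defensive.

Import Order.TTheory GRing.Theory Num.Theory.
Import numFieldNormedType.Exports.

Local Open Scope classical_set_scope.
Local Open Scope ring_scope.

(** * Vector lattice calculus *)

Section VectorLattice.
Context {R : realType} {X : banachLatticeType R}.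
Implicit Types x y z a b c : X.

Definition pospart x : X := x \vee 0.

Lemma vjoin_lub x y z : x <=v z -> y <=v z -> x \vee y <=v z.
Proof. by move=> xz yz; apply/vle_joinP. Qed.

Lemma vjoin_l x y : x <=v x \vee y.
Proof. by have /vle_joinP[] := vle_refl (x \vee y). Qed.

Lemma vjoin_r x y : y <=v x \vee y.
Proof. by have /vle_joinP[] := vle_refl (x \vee y). Qed.

Lemma vmeet_glb x y z : z <=v x -> z <=v y -> z <=v x \wedge y.
Proof. by move=> xz yz; apply/vle_meetP. Qed.

Lemma vmeet_l x y : x \wedge y <=v x.
Proof. by have /vle_meetP[] := vle_refl (x \wedge y). Qed.

Lemma vmeet_r x y : x \wedge y <=v y.
Proof. by have /vle_meetP[] := vle_refl (x \wedge y). Qed.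

Lemma vsub_ge0 x y : 0 <=v y - x <-> x <=v y.
Proof.
split=> [/(vle_add2r x)|/(vle_add2r (- x))]; first by rewrite add0r subrK.
by rewrite subrr.
Qed.

Lemma vle_add x y z w : x <=v y -> z <=v w -> x + z <=v y + w.
Proof.
move=> xy zw; apply: (@vle_trans _ _ (y + z)); first exact: vle_add2r.
by rewrite ![y + _]addrC; exact: vle_add2r.
Qed.

Lemma vadd_ge0 x y : 0 <=v x -> 0 <=v y -> 0 <=v x + y.
Proof. by move=> x0 y0; rewrite -[0]addr0; exact: vle_add. Qed.

Lemma vleBl x y z : x - y <=v z <-> x <=v z + y.
Proof. by rewrite -(vsub_ge0 (x - y)) -(vsub_ge0 x) opprB addrA. Qed.

Lemma vleBr x y z : x + y <=v z <-> x <=v z - y.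
Proof. by rewrite -(vleBl x (- y)) opprK. Qed.

Lemma vle_opp x y : x <=v y -> - y <=v - x.
Proof. by move=> /vsub_ge0 xy; apply/vsub_ge0; rewrite opprK addrC. Qed.

Lemma vle_subl x y : 0 <=v y -> x - y <=v x.
Proof. by move=> y0; apply/vsub_ge0; rewrite opprB addrC subrK. Qed.

Lemma vle_scale (t : R) x y : 0 <= t -> x <=v y -> t *: x <=v t *: y.
Proof.
move=> t0 /vsub_ge0 xy; apply/vsub_ge0; rewrite -scalerBr.
exact: vle_scale_ge0.
Qed.

Lemma vjoinD x y z : (x + z) \vee (y + z) = (x \vee y) + z.
Proof.
apply: vle_anti.
  by apply: vjoin_lub; apply: vle_add2r; [exact: vjoin_l|exact: vjoin_r].
rewrite -[X in _ <=v X](subrK z); apply: vle_add2r; apply: vjoin_lub.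
  by rewrite -[x in x <=v _](addrK z); apply: vle_add2r; exact: vjoin_l.
by rewrite -[y in y <=v _](addrK z); apply: vle_add2r; exact: vjoin_r.
Qed.

Lemma vjoin_pos x y : x \vee y = y + pospart (x - y).
Proof. by rewrite /pospart addrC -vjoinD subrK add0r. Qed.

Lemma pos_ge0 x : 0 <=v pospart x. Proof. exact: vjoin_r. Qed.

Lemma pos_ge x : x <=v pospart x. Proof. exact: vjoin_l. Qed.

Lemma pos_le x y : 0 <=v y -> x <=v y -> pospart x <=v y.
Proof. by move=> y0 xy; exact: vjoin_lub. Qed.

Lemma pos_id x : 0 <=v x -> pospart x = x.
Proof.
by move=> x0; apply: vle_anti; [apply: pos_le => //; exact: vle_refl|exact: pos_ge].
Qed.

Lemma pos_npos x : x <=v 0 -> pospart x = 0.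
Proof.
by move=> x0; apply: vle_anti; [apply: pos_le => //; exact: vle_refl|exact: pos_ge0].
Qed.

Lemma pos_mono x y : x <=v y -> pospart x <=v pospart y.
Proof.
by move=> xy; apply: pos_le (pos_ge0 _) _; apply: vle_trans xy (pos_ge _).
Qed.

Lemma posD x y : pospart (x + y) <=v pospart x + pospart y.
Proof.
by apply: pos_le; [apply: vadd_ge0; exact: pos_ge0|apply: vle_add; exact: pos_ge].
Qed.

Lemma posZ (t : R) x : 0 <= t -> pospart (t *: x) = t *: pospart x.
Proof.
rewrite le_eqVlt => /predU1P[<-|t0].
  by rewrite !scale0r pos_id//; exact: vle_refl.
apply: vle_anti.
  apply: pos_le; first by apply: vle_scale_ge0; [exact: ltW|exact: pos_ge0].
  by apply: vle_scale; [exact: ltW|exact: pos_ge].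
rewrite -[X in _ <=v X](scalerKV (lt0r_neq0 t0)); apply: vle_scale (ltW t0) _.
apply: pos_le.
  by apply: vle_scale_ge0 (pos_ge0 _); rewrite invr_ge0 ltW.
rewrite -[x in x <=v _](scalerK (lt0r_neq0 t0)).
by apply: vle_scale (pos_ge _); rewrite invr_ge0 ltW.
Qed.

Lemma posB_meet x y : pospart (x - y) = x - x \wedge y.
Proof.
apply: vle_anti.
  apply: pos_le; first by apply/vsub_ge0; exact: vmeet_l.
  by rewrite addrC [X in _ <=v X]addrC; apply: vle_add2r; apply/vle_opp/vmeet_r.
apply/vleBl; rewrite addrC; apply/vleBl; apply: vmeet_glb.
  exact/vle_subl/pos_ge0.
by apply/vleBl; rewrite addrC; apply/vleBl; exact: pos_ge.
Qed.

Lemma posBN x : pospart x - pospart (- x) = x.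
Proof.
apply/eqP; rewrite subr_eq; apply/eqP; rewrite /pospart [x + _]addrC -vjoinD addNr add0r.
by apply: vle_anti; apply: vjoin_lub; (exact: vjoin_l || exact: vjoin_r).
Qed.

(** Riesz decomposition: the part of [y] below [a] is [y /\ a], and what remains is
    [(y - a)^+]. *)
Lemma riesz2 y a b : 0 <=v y -> 0 <=v a -> 0 <=v b -> y <=v a + b ->
  exists y1 y2, [/\ y = y1 + y2, 0 <=v y1, y1 <=v a, 0 <=v y2 & y2 <=v b].
Proof.
move=> y0 a0 b0 yab; exists (y \wedge a), (y - y \wedge a).
split; first by rewrite addrC subrK.
- exact: vmeet_glb.
- exact: vmeet_r.
- by apply/vsub_ge0; exact: vmeet_l.
- by rewrite -posB_meet; apply: pos_le => //; apply/vleBl; rewrite addrC.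
Qed.

(** Riesz decomposition applied to [(a + b) /\ c], whose two parts are both below
    [c]. *)
Lemma vmeetD a b c : 0 <=v a -> 0 <=v b -> 0 <=v c ->
  (a + b) \wedge c <=v a \wedge c + b \wedge c.
Proof.
move=> a0 b0 c0; have [|//|//||u [v [uvE u0 ua v0 vb]]] :=
  @riesz2 ((a + b) \wedge c) a b; [|exact: vmeet_l|].
  by apply: vmeet_glb => //; exact: vadd_ge0.
rewrite uvE; have uvc : u + v <=v c by rewrite -uvE; exact: vmeet_r.
apply: vle_add; apply: vmeet_glb => //; apply: vle_trans uvc.
  by rewrite -[X in X <=v _]addr0; apply: vle_add => //; exact: vle_refl.
by rewrite -[X in X <=v _]add0r; apply: vle_add => //; exact: vle_refl.
Qed.

Lemma vmeet_mono x x' y y' : x <=v x' -> y <=v y' -> x \wedge y <=v x' \wedge y'.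
Proof.
by move=> xx yy; apply: vmeet_glb;
  [apply: vle_trans xx; exact: vmeet_l|apply: vle_trans yy; exact: vmeet_r].
Qed.

Lemma modulus_ge x : x <=v modulus x. Proof. exact: vjoin_l. Qed.

Lemma modulus_geN x : - x <=v modulus x. Proof. exact: vjoin_r. Qed.

Lemma modulus_le x y : x <=v y -> - x <=v y -> modulus x <=v y.
Proof. by move=> *; apply: vjoin_lub. Qed.

Lemma modulusN x : modulus (- x) = modulus x.
Proof.
have aux z : modulus (- z) <=v modulus z.
  by apply: modulus_le; rewrite ?opprK; [exact: modulus_geN|exact: modulus_ge].
by apply: vle_anti => //; rewrite -{1}[x]opprK; exact: aux.
Qed.

Lemma modulus_ge0 x : 0 <=v modulus x.
Proof.
have h := vle_add (modulus_ge x) (modulus_geN x); rewrite subrr in h.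
have h2 : 0 <= 2^-1 :> R by rewrite invr_ge0.
have := vle_scale_ge0 _ _ h2 h.
by rewrite -mulr2n -(scaler_nat 2 (modulus x)) scalerA mulVf ?pnatr_eq0// scale1r.
Qed.

Lemma modulusE x : modulus x = pospart x + pospart (- x).
Proof.
apply: vle_anti.
  apply: modulus_le; first by rewrite -[X in X <=v _]addr0; apply: vle_add (pos_ge _) (pos_ge0 _).
  by rewrite -[X in X <=v _]add0r; apply: vle_add (pos_ge0 _) (pos_ge _).
rewrite -[pospart x](subrK (pospart (- x))) posBN -addrA.
have -> : pospart (- x) + pospart (- x) = pospart (- x - x).
  by rewrite -mulr2n -[- x - x]mulr2n -(scaler_nat 2 (- x)) -(scaler_nat 2 (pospart _)) posZ.
by rewrite -vjoin_pos; apply: vjoin_lub; [exact: modulus_geN|exact: modulus_ge].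
Qed.

Lemma modulus_id x : 0 <=v x -> modulus x = x.
Proof.
move=> x0; rewrite modulusE pos_id// pos_npos ?addr0//.
by rewrite -oppr0; exact: vle_opp.
Qed.

Lemma modulusD x y : modulus (x + y) <=v modulus x + modulus y.
Proof.
apply: modulus_le; last rewrite opprD; apply: vle_add;
  (exact: modulus_ge || exact: modulus_geN).
Qed.

Lemma norm_le x y : x <=v y -> - x <=v y -> `|x| <= `|y|.
Proof.
move=> xy Nxy; apply: vnorm_solid; apply: vle_trans (modulus_ge y).
exact: modulus_le.
Qed.

Lemma norm_mono x y : 0 <=v x -> x <=v y -> `|x| <= `|y|.
Proof.
move=> x0 xy; apply: norm_le => //; have y0 := vle_trans _ _ _ x0 xy.
apply: vle_trans y0; by rewrite -oppr0; exact: vle_opp.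
Qed.

Lemma norm_modulus x : `|modulus x| = `|x|.
Proof.
have e : modulus (modulus x) = modulus x by rewrite modulus_id//; exact: modulus_ge0.
have h := vle_refl (modulus x).
apply/eqP; rewrite eq_le; apply/andP; split; apply: vnorm_solid.
  by rewrite -{1}e in h.
by rewrite -{2}e in h.
Qed.

Lemma norm_pos_le x : `|pospart x| <= `|x|.
Proof.
rewrite -(norm_modulus x); apply: norm_mono; first exact: pos_ge0.
by apply: pos_le (modulus_ge0 _) (modulus_ge _).
Qed.

Lemma pos_lip x y : `|pospart x - pospart y| <= `|x - y|.
Proof.
have aux u v : pospart u - pospart v <=v modulus (u - v).
  apply/vleBl; apply: pos_le; first by apply: vadd_ge0; [exact: modulus_ge0|exact: pos_ge0].
  by rewrite -[u in u <=v _](subrK v); apply: vle_add (modulus_ge _) (pos_ge _).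
rewrite -(norm_modulus (x - y)); apply: norm_le => //.
by rewrite opprB -modulusN opprB.
Qed.

(** Passing to the negative part is a contraction, and the points [y] have
    none. *)
Lemma vge0_closed x :
  (forall e : R, 0 < e -> exists2 y, 0 <=v y & `|x - y| <= e) -> 0 <=v x.
Proof.
move=> h; rewrite -[x]posBN; suff -> : pospart (- x) = 0 by rewrite subr0; exact: pos_ge0.
apply/eqP; rewrite -normr_eq0 eq_le normr_ge0 andbT.
apply/ler_addgt0Pr => e e0; rewrite add0r; have [y y0 xy] := h e e0.
apply: le_trans xy; rewrite -[pospart (- x)]subr0 -(@pos_npos (- y)).
  by apply: le_trans (pos_lip _ _) _; rewrite -opprD normrN.
by rewrite -oppr0; exact: vle_opp.
Qed.

End VectorLattice.

(** * The Hahn-Banach theorem *)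

Section HahnBanach.
Context {R : realType} {V : lmodType R}.
Implicit Types (p q f : V -> R) (x y z : V).

Definition sublinear p :=
  (forall x y, p (x + y) <= p x + p y) /\
  (forall (t : R) x, 0 <= t -> p (t *: x) = t * p x).

Lemma sublinear_intro p : p 0 = 0 ->
  (forall x y, p (x + y) <= p x + p y) ->
  (forall (t : R) x, 0 < t -> p (t *: x) <= t * p x) -> sublinear p.
Proof.
move=> p0 pD pZ; split=> // t x; rewrite le_eqVlt => /predU1P[<-|t0].
  by rewrite scale0r mul0r.
apply/eqP; rewrite eq_le pZ//= -ler_pdivlMl//.
by rewrite -{1}[x](scalerK (lt0r_neq0 t0)) pZ// invr_gt0.
Qed.

Lemma sublinear0 p : sublinear p -> p 0 = 0.
Proof. by move=> [_ /(_ 0 0 (lexx _))]; rewrite scale0r mul0r. Qed.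

(** [shift p y] is the sublinear minorant of [p] that takes the value [- p y] at
    [- y], obtained by linearising [p] along [y]. *)
Definition shifts p y x : set R :=
  [set p (x + t *: y) - t * p y | t in [set t | 0 <= t]].

Definition shift p y x : R := inf (shifts p y x).

Section Shift.
Context (p : V -> R) (y : V) (sp : sublinear p).

Let shift_lb x : lbound (shifts p y x) (- p (- x)).
Proof.
move=> _ [t /= t0 <-]; rewrite -sp.2// lerBrDr addrC lerBlDr addrC.
by have := sp.1 (x + t *: y) (- x); rewrite addrAC subrr add0r addrC.
Qed.

Lemma shift_le x (t : R) : 0 <= t -> shift p y x <= p (x + t *: y) - t * p y.
Proof. by move=> t0; apply: ge_inf; [exists (- p (- x))|exists t]. Qed.

Lemma shift_ge x c :
  (forall t : R, 0 <= t -> c <= p (x + t *: y) - t * p y) -> c <= shift p y x.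
Proof.
move=> h; apply: lb_le_inf; last by move=> _ [t t0 <-]; exact: h.
by exists (p (x + 0 *: y) - 0 * p y); exists 0 => /=.
Qed.

Lemma shift_sublinear : sublinear (shift p y).
Proof.
apply: sublinear_intro.
- apply/eqP; rewrite eq_le; apply/andP; split.
    by have := shift_le 0 (lexx 0); rewrite mul0r scale0r addr0 subr0 (sublinear0 sp).
  by apply: shift_ge => t t0; rewrite add0r sp.2// subrr.
- move=> a b; rewrite -lerBlDr; apply: shift_ge => t t0.
  rewrite lerBlDr -lerBlDl; apply: shift_ge => s s0; rewrite lerBlDl.
  apply: le_trans (shift_le (a + b) (addr_ge0 t0 s0)) _.
  have := sp.1 (a + t *: y) (b + s *: y); rewrite addrACA -scalerDl; lra.
- move=> t x t0; rewrite -ler_pdivrMl//; apply: shift_ge => s s0.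
  rewrite ler_pdivrMl//; apply: le_trans (shift_le _ (mulr_ge0 (ltW t0) s0)) _.
  by rewrite -scalerA -scalerDr (sp.2 _ _ (ltW t0)) mulrBr mulrA.
Qed.

End Shift.

(** A minimal sublinear minorant [q], given by Zorn's lemma, equals each of its
    shifts [shift q y]; this makes it superadditive, hence linear. *)
Lemma linear_minorant p : sublinear p ->
  exists f, [/\ forall x y, f (x + y) = f x + f y,
    forall (t : R) x, f (t *: x) = t * f x & forall x, f x <= p x].
Proof.
move=> sp.
pose T := {q : V -> R | sublinear q /\ forall x, q x <= p x}.
pose rel (q1 q2 : T) := `[< forall x, sval q2 x <= sval q1 x >].
have [| | | |[q [sq qp]] qmin] := @Zorn T rel.
- by move=> t; apply/asboolP.
- move=> r s t /asboolP rs /asboolP st; apply/asboolP => x.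
  exact: le_trans (st x) (rs x).
- move=> [s Ps] [t Pt] /asboolP st /asboolP ts; apply: eq_exist => /=.
  by apply/funext => x; apply: le_anti; rewrite st ts.
- move=> A Atot; have [->|/set0P[q0 Aq0]] := eqVneq A set0.
    by exists (exist _ p (conj sp (fun x => lexx (p x)))).
  pose Q x : set R := [set sval s x | s in A].
  have Qlb x : lbound (Q x) (- p (- x)).
    move=> _ [[s [ss sp']] As <-] /=.
    rewrite lerNl; apply: le_trans (sp' (- x)); rewrite lerNl.
    by rewrite -subr_ge0 opprK -(sublinear0 ss) -(subrr x) ss.1.
  have Q_le x s : A s -> inf (Q x) <= sval s x.
    by move=> As; apply: ge_inf; [exists (- p (- x))|exists s].
  have Q_ge x c : (forall s, A s -> c <= sval s x) -> c <= inf (Q x).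
    move=> h; apply: lb_le_inf; first by exists (sval q0 x), q0.
    by move=> _ [s As <-]; exact: h.
  have H : sublinear (fun x => inf (Q x)) /\ forall x, inf (Q x) <= p x.
    split; last by move=> x; apply: le_trans (Q_le x _ Aq0) _; exact: (svalP q0).2.
    apply: sublinear_intro.
    - apply/eqP; rewrite eq_le; apply/andP; split.
        by apply: le_trans (Q_le _ _ Aq0) _; rewrite (sublinear0 (svalP q0).1).
      by apply: (Q_ge) => -[s [ss sp']] _ /=; rewrite sublinear0.
    - (* two members of the chain are comparable: use the smaller one at both points *)
      move=> x y; rewrite -lerBlDr; apply: (Q_ge) => s As.
      rewrite lerBlDr -lerBlDl; apply: (Q_ge) => r Ar; rewrite lerBlDl.
      have [/asboolP sr|/asboolP rs] := Atot s r As Ar.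
        apply: le_trans (Q_le (x + y) r Ar) _.
        by apply: le_trans ((svalP r).1.1 x y) _; rewrite lerD2r.
      apply: le_trans (Q_le (x + y) s As) _.
      by apply: le_trans ((svalP s).1.1 x y) _; rewrite lerD2l.
    - move=> t x t0; rewrite -ler_pdivrMl//; apply: (Q_ge) => s As.
      by rewrite ler_pdivrMl// -((svalP s).1.2 _ _ (ltW t0)); exact: Q_le.
  pose i : T := exist _ (fun x => inf (Q x)) H.
  by exists i => s As; apply/asboolP => x; exact: Q_le.
have {}qmin y : shift q y = q.
  have H : sublinear (shift q y) /\ forall x, shift q y x <= p x.
    split; first exact: shift_sublinear.
    move=> x; apply: le_trans (shift_le y sq x (lexx 0)) _.
    by rewrite mul0r scale0r addr0 subr0.
  pose i : T := exist _ (shift q y) H.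
  suff /qmin/(congr1 sval) : rel (exist _ q (conj sq qp)) i by [].
  apply/asboolP => x /=; apply: le_trans (shift_le y sq x (lexx 0)) _.
  by rewrite mul0r scale0r addr0 subr0.
have qD x y : q (x + y) = q x + q y.
  apply: le_anti; rewrite sq.1/= -lerBrDr -{1}(qmin y).
  by have := shift_le y sq x ler01; rewrite scale1r mul1r.
exists q; split => // t x; have [t0|t0] := leP 0 t; first exact: sq.2.
have qN z : q (- z) = - q z.
  by apply/eqP; rewrite -addr_eq0 -qD addNr (sublinear0 sq).
by rewrite -[t]opprK scaleNr qN sq.2 ?mulNr ?opprK// oppr_ge0 ltW.
Qed.

(** Any linear minorant of [shift p z] works: it is at most [- p z] at [- z]. *)
Lemma hahn_banach p z : sublinear p ->
  exists f, [/\ forall x y, f (x + y) = f x + f y,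
    forall (t : R) x, f (t *: x) = t * f x, forall x, f x <= p x & f z = p z].
Proof.
move=> sp; have [f [fD fZ fp]] := linear_minorant (shift_sublinear z sp).
have {}fp x : f x <= p x /\ f (- z) <= - p z.
  split; apply: le_trans (fp _) _.
    by have := shift_le z sp x (lexx 0); rewrite scale0r mul0r addr0 subr0.
  have := shift_le z sp (- z) ler01.
  by rewrite scale1r mul1r addNr (sublinear0 sp) sub0r.
exists f; split => //; first by move=> x; have [] := fp x.
apply: le_anti; rewrite (fp z).1/= -lerN2 -[leLHS]mulN1r -fZ scaleN1r.
by have [] := fp z.
Qed.

End HahnBanach.

(** * Total boundedness and un-compactness *)

Section TotallyBounded.
Context {R : realType}.

Definition totally_bounded (V : normedModType R) (A : set V) :=
  forall e : R, 0 < e ->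
    exists L : seq V, forall a, A a -> exists2 b, b \in L & `|a - b| < e.

Section NormedModule.
Context {V W : normedModType R}.
Implicit Types A B : set V.

Lemma totally_bounded_sub A B : A `<=` B -> totally_bounded B -> totally_bounded A.
Proof. by move=> AB tB e /tB[L LP]; exists L => a /AB/LP. Qed.

Lemma totally_bounded_lip (f : V -> W) (C : R) A :
  0 < C -> (forall x y, `|f x - f y| <= C * `|x - y|) ->
  totally_bounded A -> totally_bounded (f @` A).
Proof.
move=> C0 fC tA e e0; have [L LP] := tA (e / C) (divr_gt0 e0 C0).
exists (map f L) => _ [a Aa <-]; have [b bL ab] := LP a Aa.
exists (f b); first exact: map_f.
by apply: le_lt_trans (fC _ _) _; rewrite mulrC -ltr_pdivlMr.
Qed.

Lemma totally_bounded_add A B : totally_bounded A -> totally_bounded B ->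
  totally_bounded [set a + b | a in A & b in B].
Proof.
move=> tA tB e e0; have e20 : 0 < e / 2 by rewrite divr_gt0.
have [L LP] := tA _ e20; have [M MP] := tB _ e20.
exists [seq a + b | a <- L, b <- M] => _ [a Aa [b Bb <-]].
have [a' aL aa'] := LP a Aa; have [b' bM bb'] := MP b Bb.
exists (a' + b'); first by apply/allpairsP; exists (a', b').
rewrite opprD addrACA; apply: le_lt_trans (ler_normD _ _) _.
by rewrite [ltRHS]splitr ltrD.
Qed.

Lemma totally_bounded_approx A :
  (forall e : R, 0 < e -> exists2 B : set V, totally_bounded B &
     forall a, A a -> exists2 b, B b & `|a - b| < e) -> totally_bounded A.
Proof.
move=> h e e0; have e20 : 0 < e / 2 by rewrite divr_gt0.
have [B tB AB] := h _ e20; have [L LP] := tB _ e20.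
exists L => a /AB[b /LP[c cL bc] ab]; exists c => //.
rewrite -(subrKA b); apply: le_lt_trans (ler_normD _ _) _.
by rewrite [ltRHS]splitr ltrD.
Qed.

Lemma totally_bounded1 (x : V) : totally_bounded [set x].
Proof.
move=> e e0; exists [:: x] => _ ->; exists x; first by rewrite inE.
by rewrite subrr normr0.
Qed.

(** The finite net is a mesh of the segment, of step [e / |v|]. *)
Lemma totally_bounded_line (c : R) (v : V) :
  totally_bounded [set t *: v | t in [set t : R | `|t| <= c]].
Proof.
move=> e e0; have [v0|v0] := eqVneq v 0.
  by exists [:: 0] => _ [t _ <-]; exists 0; rewrite ?inE// v0 scaler0 subrr normr0.
have nv0 : 0 < `|v| by rewrite normr_gt0.
pose d := e / `|v|; have d0 : 0 < d by rewrite divr_gt0.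
pose N := (Num.truncn (2 * c / d)).+1.
pose g (i : nat) := (i%:R * d - c) *: v.
exists (map g (iota 0 N)) => _ [t tc <-]; rewrite /= in tc.
have c0 : 0 <= c by rewrite (le_trans _ tc).
move: tc; rewrite ler_norml => /andP[ct tc].
have s0 : 0 <= (t + c) / d by apply: divr_ge0; [lra|exact: ltW].
pose i := Num.truncn ((t + c) / d).
exists (g i).
  apply: map_f; rewrite mem_iota add0n/= ltnS.
  by apply: le_truncn; rewrite ler_pM2r ?invr_gt0//; lra.
rewrite -scalerBl normrZ -ltr_pdivlMr// -/d.
have /andP[i1 i2] := truncn_itv s0; rewrite -/i in i1 i2.
rewrite ler_pdivlMr// in i1; rewrite ltr_pdivrMr// -natr1 in i2.
by rewrite ltr_norml; apply/andP; split; lra.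
Qed.

End NormedModule.
End TotallyBounded.

Section UnCompact.
Context {R : realType} {F : banachLatticeType R}.
Implicit Types A B : set F.

Lemma tails_filter (I : Type) (le : I -> I -> Prop) :
  directed le -> ProperFilter (tails le).
Proof.
move=> [[i0] lerr letr leub]; split; first by move=> [i h]; exact: h i (lerr i).
split; first by exists i0.
- move=> P Q [i iP] [j jQ]; have [k [ik jk]] := leub i j.
  exists k => l kl; split; [apply: iP|apply: jQ]; exact: letr kl.
- by move=> P Q PQ [i iP]; exists i => j /iP /PQ.
Qed.

Lemma ultra_cover (T : Type) (I : eqType) (U : set_system T) (S : I -> set T)
    (L : seq I) :
  UltraFilter U -> U [set x | exists2 i, i \in L & S i x] ->
  exists2 i, i \in L & U (S i).
Proof.
move=> UU; elim: L => [|i L IH] UL.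
  have [x [//]] := @filter_ex _ U _ _ UL.
have [Si|Si] := in_ultra_setVsetC (S i) UU; first by exists i; rewrite ?mem_head.
have [|j jL Sj] := IH; last by exists j; rewrite // in_cons jL orbT.
apply: filterS (filterI UL Si) => x [[j]]; rewrite in_cons => /predU1P[->//|jL Sj _].
by exists j.
Qed.

(** An ultrafilter finer than the tails of the net contains a ball of each radius,
    because finitely many of them cover [A]; so it converges. *)
Lemma totally_bounded_cluster (I : Type) (le : I -> I -> Prop) (y : I -> F) A :
  directed le -> totally_bounded A -> (forall i, A (y i)) ->
  exists l, forall (e : R) i0, 0 < e -> exists2 i, le i0 i & `|y i - l| < e.
Proof.
move=> dle tA yA; have TF := tails_filter dle.
have [U [UU yU]] := @ultraFilterLemma F (y @ tails le) _.
have : cauchy U.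
  apply: cauchy_exP => e e0; have [L LP] := tA e e0.
  have [|x _ xU] := @ultra_cover F F U (fun b => ball b e) L; last by exists x.
  apply: yU; have [i0] := directed_inhabited dle; exists i0 => i _ /=.
  have [b bL yb] := LP _ (yA i); exists b => //.
  by rewrite -ball_normE /= distrC.
move=> /cauchy_cvg /cvg_ex [l Ul]; exists l => e i0 e0.
have Ub : U (ball l e) by apply: Ul; exact: nbhsx_ballx.
have Ui : U [set y i | i in le i0].
  by apply: yU; exists i0 => i ii0; exists i.
have [x [+ [i ii0 yi]]] := @filter_ex _ U _ _ (filterI Ub Ui).
by rewrite -ball_normE /= distrC -yi; exists i.
Qed.

Lemma totally_bounded_un_compact A : totally_bounded A -> un_compact A.
Proof.
move=> tA I le y dle yA; have [l lP] := totally_bounded_cluster dle tA yA.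
(* the subnet runs over the indices at which the net is close to its cluster
   point [l], paired with the precision reached there *)
pose J := {p : I * nat | `|y p.1 - l| < p.2.+1%:R^-1}.
pose leJ (p q : J) := le (sval p).1 (sval q).1 /\ ((sval p).2 <= (sval q).2)%N.
have inv0 n : 0 < n.+1%:R^-1 :> R by rewrite invr_gt0.
have [[lerr letr] leub] := (directed_refl dle, directed_trans dle, directed_ub dle).
have dJ : directed leJ.
  split.
  - have [i0] := directed_inhabited dle.
    by have [i _ yi] := lP _ i0 (inv0 0%N); split; exists (i, 0%N).
  - by move=> p; split.
  - move=> p q r [pq1 pq2] [qr1 qr2].
    by split; [exact: letr qr1|exact: leq_trans qr2].
  - move=> p q; have [k [pk qk]] := leub (sval p).1 (sval q).1.
    pose n := maxn (sval p).2 (sval q).2.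
    have [i ki yi] := lP _ k (inv0 n); exists (exist _ (i, n) yi).
    by split; (split; [exact: letr ki|rewrite /= ?leq_maxl ?leq_maxr]).
exists J, leJ, (fun p => (sval p).1), l; split => //.
  move=> i0; have [i ii0 yi] := lP _ i0 (inv0 0%N).
  by exists (exist _ (i, 0%N) yi) => j [/= ij _]; exact: letr ij.
move=> u u0; have JF := tails_filter dJ.
apply/cvgr0Pnorm_le => e e0.
have [i0] := directed_inhabited dle.
pose n := Num.truncn e^-1.
have [i _ yi] := lP _ i0 (inv0 n); exists (exist _ (i, n) yi) => -[[j m] yj] [_ /= nm].
rewrite normr_id; apply: (@le_trans _ _ `|y j - l|).
  rewrite -(norm_modulus (y j - l)); apply: norm_mono; last exact: vmeet_l.
  by apply: vmeet_glb => //; exact: modulus_ge0.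
apply: le_trans (ltW yj) _; rewrite -[e]invrK lef_pV2 ?posrE ?invr_gt0//=.
apply: le_trans (ltW (truncnS_gt _)) _; by rewrite ler_nat ltnS.
Qed.

(** Inside [[- w, w]] un-convergence of a net forces it to be norm Cauchy, as
    [|y i - y j|] is its own infimum with [2 w].  If no finite list covered [A]
    up to [e], picking for each list a point of [A] away from it would give a
    net, indexed by lists ordered by inclusion, without such a subnet. *)
Lemma un_compact_totally_bounded A (w : F) :
  (forall a, A a -> - w <=v a /\ a <=v w) -> un_compact A -> totally_bounded A.
Proof.
move=> Aw cA e e0; apply: contrapT => /forallNP nL.
have /choice[y yP] (L : seq F) :
    exists a, A a /\ forall b, b \in L -> e <= `|a - b|.
  have /existsNP[a /not_implyP[Aa aL]] := nL L.
  exists a; split => // b bL; rewrite leNgt; apply/negP => ab.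
  by apply: aL; exists b.
pose le (L M : seq F) := {subset L <= M}.
have dle : directed le.
  split.
  - by split; exact: [::].
  - by move=> L.
  - by move=> L M N LM MN x /LM /MN.
  - move=> L M; exists (L ++ M).
    by split=> x xL; rewrite mem_cat xL ?orbT.
have [J [leJ [phi [l [dJ sub yl]]]]] := cA _ le y dle (fun L => (yP L).1).
have w0 : 0 <=v w + w.
  have [+ +] := Aw _ (yP [::]).1 => /vle_trans h /h /(vle_add2r w).
  by rewrite addNr.
have JF := tails_filter dJ.
have e20 : 0 < e / 2 by rewrite divr_gt0.
have /cvgr0Pnorm_lt/(_ _ e20)[j0 j0P] := yl _ w0.
have [j1 j1P] := sub [:: y (phi j0)].
have [k [j0k j1k]] := directed_ub dJ j0 j1.
have y0k : e <= `|y (phi k) - y (phi j0)|.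
  by apply: (yP _).2; apply: (j1P _ j1k); rewrite inE.
suff : `|y (phi k) - y (phi j0)| < e by rewrite ltNge y0k.
have := ltrD (j0P _ j0k) (j0P _ (directed_refl dJ j0)); rewrite -splitr !normr_id /=.
apply: le_lt_trans; apply: le_trans (ler_normD _ _); rewrite -norm_modulus.
apply: norm_mono; first exact: modulus_ge0.
apply: vle_trans (vmeetD (modulus_ge0 _) (modulus_ge0 _) w0).
apply: vmeet_glb.
  rewrite -(modulusN (y (phi j0) - l)); apply: vle_trans (modulusD _ _).
  by rewrite opprB subrKA; exact: vle_refl.
have [a1 a2] := Aw _ (yP (phi k)).1; have [b1 b2] := Aw _ (yP (phi j0)).1.
apply: modulus_le.
  by apply: vle_add => //; rewrite -[w]opprK; exact: vle_opp.
by rewrite opprB addrC; apply: vle_add => //; rewrite -[w]opprK; exact: vle_opp.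
Qed.

End UnCompact.

(** * Linear maps, operator norms and AL-spaces *)

Section LinearMaps.
Context {R : realType} {V W : lmodType R} (T : V -> W) (lT : linear T).

Lemma linear_map_Z (t : R) x : T (t *: x) = t *: T x.
Proof.
have T0 : T 0 = 0.
  by have := lT 1 0 0; rewrite !scale1r !addr0 => /(congr1 (fun y => y - T 0));
     rewrite subrr addrK.
by have := lT t x 0; rewrite !addr0 T0 addr0.
Qed.

Lemma linear_map_0 : T 0 = 0.
Proof. by rewrite -(scale0r (0 : V)) linear_map_Z scale0r. Qed.

Lemma linear_map_D x y : T (x + y) = T x + T y.
Proof. by have := lT 1 x y; rewrite !scale1r. Qed.

Lemma linear_map_N x : T (- x) = - T x.
Proof. by rewrite -scaleN1r linear_map_Z scaleN1r. Qed.

Lemma linear_map_B x y : T (x - y) = T x - T y.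
Proof. by rewrite linear_map_D linear_map_N. Qed.

Lemma linear_map_sum (I : Type) (s : seq I) (f : I -> V) :
  T (\sum_(i <- s) f i) = \sum_(i <- s) T (f i).
Proof. by rewrite (big_morph T linear_map_D linear_map_0). Qed.

End LinearMaps.

Section OperatorNorm.
Context {R : realType} {E F : banachLatticeType R}.
Implicit Types S T : E -> F.

Lemma linear_continuous_bounded T : linear T -> continuous T ->
  exists2 C : R, 0 < C & forall x, `|T x| <= C * `|x|.
Proof.
move=> lT cT.
pose L : {linear E -> F} := HB.pack T (GRing.isLinear.Build R E F *:%R T lT).
have /linear_bounded_continuous/linear_boundedP : continuous L by [].
by move=> /pinfty_ex_gt0[C C0 h]; exists C.
Qed.

Lemma linear_bounded_continuous_fun T (C : R) : linear T ->
  (forall x, `|T x| <= C * `|x|) -> continuous T.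
Proof.
move=> lT CT.
pose L : {linear E -> F} := HB.pack T (GRing.isLinear.Build R E F *:%R T lT).
suff : continuous L by [].
apply/linear_bounded_continuous/linear_boundedP.
apply: filterS (nbhs_pinfty_ge (num_real C)) => r Cr x.
by apply: le_trans (CT x) _; apply: ler_wpM2r.
Qed.

Lemma op_norm_le T (C : R) :
  (forall x, `|x| <= 1 -> `|T x| <= C) -> op_norm T <= C.
Proof.
move=> h; apply: ge_sup; last by move=> _ [x /= x1 <-]; exact: h.
by exists `|T 0|; exists 0 => //=; rewrite normr0.
Qed.

Definition bounded_op T := exists C : R, forall x, `|T x| <= C * `|x|.

Lemma op_norm_ub T x : bounded_op T -> `|x| <= 1 -> `|T x| <= op_norm T.
Proof.
move=> [C CT] x1; apply: ub_le_sup; last by exists x.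
exists `|C| => _ [y /= y1 <-]; apply: le_trans (CT y) _.
apply: (@le_trans _ _ (`|C| * `|y|)); first by apply: ler_wpM2r => //; exact: ler_norm.
by rewrite -[leRHS]mulr1; apply: ler_wpM2l.
Qed.

Lemma op_norm_ge0 T : bounded_op T -> 0 <= op_norm T.
Proof.
by move=> bT; apply: le_trans (op_norm_ub (x := 0) bT _); rewrite ?normr0.
Qed.

Lemma op_norm_bound T x : linear T -> bounded_op T -> `|T x| <= op_norm T * `|x|.
Proof.
move=> lT bT; have [->|x0] := eqVneq x 0.
  by rewrite linear_map_0// !normr0 mulr0.
have nx0 : 0 < `|x| by rewrite normr_gt0.
rewrite -ler_pdivrMr// mulrC -[X in X * _]ger0_norm ?invr_ge0// -normrZ.
rewrite -linear_map_Z//; apply: op_norm_ub => //.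
by rewrite normrZ normrV ?unitf_gt0// normr_id mulVf ?gt_eqF.
Qed.

Lemma positive_op_mono T x y : linear T -> op_le 0 T -> x <=v y -> T x <=v T y.
Proof.
move=> lT T0 /vsub_ge0 xy; apply/vsub_ge0; rewrite -linear_map_B//.
exact: T0.
Qed.

Lemma dominated_op_modulus S T x : linear S -> linear T ->
  op_le T S -> op_le (- T) S -> T x <=v S (modulus x) /\ - T x <=v S (modulus x).
Proof.
move=> lS lT TS NTS; rewrite -{1 3}(posBN x) modulusE (linear_map_D lS) (linear_map_B lT).
have := TS _ (pos_ge0 x); have := TS _ (pos_ge0 (- x)).
have := NTS _ (pos_ge0 x); have := NTS _ (pos_ge0 (- x)).
by rewrite opprB; split; [|rewrite addrC]; apply: vle_add.
Qed.

Lemma dominated_op_bound S T x : linear S -> linear T ->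
  op_le T S -> op_le (- T) S -> `|T x| <= `|S (modulus x)|.
Proof.
move=> lS lT TS NTS; have [] := dominated_op_modulus x lS lT TS NTS.
exact: norm_le.
Qed.

Lemma dominated_op_bounded S T : linear S -> linear T -> bounded_op S ->
  op_le T S -> op_le (- T) S -> bounded_op T.
Proof.
move=> lS lT [C CS] TS NTS; exists C => x.
apply: le_trans (dominated_op_bound x lS lT TS NTS) _.
by rewrite -(norm_modulus x).
Qed.

Lemma op_norm_mono S T : linear S -> linear T -> bounded_op S ->
  op_le T S -> op_le (- T) S -> op_norm T <= op_norm S.
Proof.
move=> lS lT bS TS NTS; apply: op_norm_le => x x1.
apply: le_trans (dominated_op_bound x lS lT TS NTS) _.
by apply: op_norm_ub => //; rewrite norm_modulus.
Qed.

Lemma op_leN T : op_le 0 T -> op_le (- T) T.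
Proof.
move=> T0 x x0; apply: (@vle_trans _ _ 0); last exact: T0.
by rewrite -oppr0; apply/vle_opp/T0.
Qed.

End OperatorNorm.

Section ALSpace.
Context {R : realType} {F : banachLatticeType R} (FAL : is_AL_space F).
Implicit Types D : set F.

Lemma AL_normB (x y : F) : 0 <=v x -> x <=v y -> `|y - x| = `|y| - `|x|.
Proof.
move=> x0 xy; apply/eqP; rewrite eq_sym subr_eq -FAL ?subrK//.
exact/vsub_ge0.
Qed.

(** In an AL-space the norms of an increasing net are nondecreasing and control
    its increments, so that a norm bounded increasing net converges to its
    supremum. *)
Lemma AL_directed_sup D (M : R) : D !=set0 ->
  (forall a, D a -> 0 <=v a) -> (forall a, D a -> `|a| <= M) ->
  (forall a b, D a -> D b -> exists2 c, D c & a <=v c /\ b <=v c) ->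
  exists g, [/\ forall a, D a -> a <=v g,
    forall u, (forall a, D a -> a <=v u) -> g <=v u
    & forall e : R, 0 < e -> exists2 a, D a & `|g - a| < e].
Proof.
move=> [d0 Dd0] D0 DM Ddir.
pose s := sup [set `|a| | a in D].
have hs : has_sup [set `|a| | a in D].
  by split; [exists `|d0|, d0|exists M => _ [a /DM aM <-]].
have s_ub a : D a -> `|a| <= s by move=> Da; apply: sup_upper_bound hs _ _; exists a.
(* the members of [D] whose norm is within [e] of the supremum are at distance
   at most [2 e] from each other: these sets are the base of a Cauchy filter *)
pose top (e : R) := [set a | D a /\ s - e < `|a|].
have top_ex e : 0 < e -> exists a, top e a.
  by move=> e0; have [_ [a Da <-] sa] := sup_adherent e0 hs; exists a.
have top_near e a c : top e a -> D c -> a <=v c -> `|c - a| < e.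
  move=> [Da sa] Dc ac; rewrite AL_normB//; last exact: D0.
  by have := s_ub _ Dc; lra.
pose U := [set P : set F | exists2 e, 0 < e & top e `<=` P].
have UF : ProperFilter U.
  split; first by move=> [e e0 h]; have [a /h] := top_ex e e0.
  split; first by exists 1.
  - move=> P Q [e e0 eP] [e' e'0 eQ]; exists (Num.min e e'); first by rewrite lt_min e0.
    by move=> a [Da sa]; split; [apply: eP|apply: eQ]; split => //;
      apply: le_lt_trans sa; rewrite lerB// ge_min lexx ?orbT.
  - by move=> P Q PQ [e e0 eP]; exists e => // a /eP /PQ.
have : cauchy U.
  apply: cauchy_exP => e e0; have e20 : 0 < e / 2 by rewrite divr_gt0.
  have [a ta] := top_ex _ e20; exists a, (e / 2) => // b tb.
  have [c Dc [ac bc]] := Ddir _ _ ta.1 tb.1; rewrite -ball_normE /=.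
  rewrite -(subrKA c) [e]splitr; apply: le_lt_trans (ler_normD _ _) _.
  by apply: ltrD; [rewrite distrC|]; apply: top_near.
move=> /cauchy_cvg /cvg_ex[g Ug].
have g_near e : 0 < e -> exists2 e', 0 < e' & forall a, top e' a -> `|g - a| < e.
  move=> e0; have [|e' e'0 h] := Ug (ball g e); first exact: nbhsx_ballx.
  by exists e' => // a /h; rewrite -ball_normE.
exists g; split.
- move=> a Da; apply/vsub_ge0/vge0_closed => e e0; have [e' e'0 h] := g_near e e0.
  have [b tb] := top_ex e' e'0; have [c Dc [ac bc]] := Ddir _ _ Da tb.1.
  exists (c - a); first exact/vsub_ge0.
  rewrite opprB addrA subrK; apply/ltW/h; split => //.
  by apply: lt_le_trans tb.2 _; apply: norm_mono => //; exact: D0 tb.1.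
- move=> u Du; apply/vsub_ge0/vge0_closed => e e0; have [e' e'0 h] := g_near e e0.
  have [b tb] := top_ex e' e'0; exists (u - b); first by apply/vsub_ge0/Du/tb.1.
  rewrite opprB addrC subrKA distrC; exact/ltW/h.
- move=> e e0; have [e' e'0 h] := g_near e e0.
  by have [b tb] := top_ex e' e'0; exists b; [exact: tb.1|exact: h].
Qed.

End ALSpace.

(** * Partitions of positive elements *)

Section Partitions.
Context {R : realType} {E F : banachLatticeType R}.
Implicit Types (s t r : seq E) (x y a : E) (f : E -> F).

Definition cone_partition s x :=
  (forall z, z \in s -> 0 <=v z) /\ \sum_(z <- s) z = x.

Lemma partition1 x : 0 <=v x -> cone_partition [:: x] x.
Proof. by move=> x0; split; [move=> z; rewrite inE => /eqP->|rewrite big_seq1]. Qed.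

Lemma partition_cat s t x y : cone_partition s x -> cone_partition t y ->
  cone_partition (s ++ t) (x + y).
Proof.
move=> [s0 <-] [t0 <-]; split; last by rewrite big_cat.
by move=> z; rewrite mem_cat => /orP[/s0|/t0].
Qed.

Lemma partition_cons a s x : cone_partition (a :: s) x ->
  0 <=v a /\ cone_partition s (x - a).
Proof.
move=> [s0 <-]; split; first by apply: s0; rewrite mem_head.
split; first by move=> z zs; apply: s0; rewrite in_cons zs orbT.
by rewrite big_cons addrAC subrr add0r.
Qed.

Lemma partition_ge0 s x : cone_partition s x -> 0 <=v x.
Proof.
elim: s x => [|a s IH] x; first by move=> [_ <-]; rewrite big_nil; exact: vle_refl.
by move=> /partition_cons[a0 /IH xa0]; rewrite -(subrK a x); exact: vadd_ge0.
Qed.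

(** Riesz decomposition along a partition: the entries of [r] are the pairs of
    complementary parts cut by [y] out of the entries of [s]. *)
Lemma riesz_seq s x y : cone_partition s x -> 0 <=v y -> y <=v x ->
  exists r : seq (E * E), [/\ s = [seq p.1 + p.2 | p <- r],
    cone_partition (map fst r) y & cone_partition (map snd r) (x - y)].
Proof.
elim: s x y => [|a s IH] x y.
  move=> [_]; rewrite big_nil => <- y0 y1; exists [::].
  by have -> : y = 0 by [apply: vle_anti]; rewrite subr0; split => //; split;
    rewrite ?big_nil.
move=> /partition_cons[a0 sx] y0 yx.
have [||y1 [y2 [-> y10 y1a y20 y2x]]] := @riesz2 _ _ y a (x - a) y0 a0.
- exact: partition_ge0 sx.
- by rewrite addrC subrK.
have [r [-> r1 r2]] := IH _ _ sx y20 y2x; exists ((y1, a - y1) :: r); split.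
- by rewrite /= addrC subrK.
- by rewrite /= -cat1s; apply: partition_cat => //; exact: partition1.
- rewrite /= -cat1s (_ : x - _ = a - y1 + (x - a - y2)).
    by apply: partition_cat => //; apply: partition1; exact/vsub_ge0.
  by rewrite [RHS]addrACA -opprD [a + _]addrC subrK.
Qed.

Definition variation f s : F := \sum_(z <- s) f z.

Lemma variation_cat f s t : variation f (s ++ t) = variation f s + variation f t.
Proof. by rewrite /variation big_cat. Qed.

Lemma variation_le f (g : E -> F) s : (forall z, z \in s -> f z <=v g z) ->
  variation f s <=v variation g s.
Proof.
rewrite /variation; elim: s => [|a s IH] h; first by rewrite !big_nil; exact: vle_refl.
rewrite !big_cons; apply: vle_add; first by apply: h; rewrite mem_head.
by apply: IH => z zs; apply: h; rewrite in_cons zs orbT.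
Qed.

Lemma variation_ge0 f s : (forall z, 0 <=v f z) -> 0 <=v variation f s.
Proof.
move=> f0; rewrite /variation; elim: s => [|a s IH]; first by rewrite big_nil; exact: vle_refl.
by rewrite big_cons; exact: vadd_ge0.
Qed.

Section Subadditive.
Context (f : E -> F) (f0 : f 0 = 0) (f_ge0 : forall x, 0 <=v f x)
  (fD : forall x y, f (x + y) <=v f x + f y).

Lemma variation_split (r : seq (E * E)) :
  variation f [seq p.1 + p.2 | p <- r] <=v
  variation f (map fst r) + variation f (map snd r).
Proof.
rewrite /variation; elim: r => [|p r IH] /=.
  by rewrite !big_nil addr0; exact: vle_refl.
by rewrite !big_cons addrACA; apply: vle_add.
Qed.

Lemma variation_sum s x : cone_partition s x -> f x <=v variation f s.
Proof.
move=> [_ <-]; rewrite /variation; elim: s => [|a s IH].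
  by rewrite !big_nil f0; exact: vle_refl.
rewrite !big_cons; apply: vle_trans (fD _ _) _; apply: vle_add => //; exact: vle_refl.
Qed.

(** Two partitions have a common refinement, and refining increases the
    variation of a subadditive function. *)
Lemma variation_directed s t x : cone_partition s x -> cone_partition t x ->
  exists2 r, cone_partition r x &
    variation f s <=v variation f r /\ variation f t <=v variation f r.
Proof.
elim: s t x => [|a s IH] t x.
  by move=> _ pt; exists t => //; split; [rewrite /variation big_nil; exact: variation_ge0|exact: vle_refl].
move=> /partition_cons[a0 ps] pt.
have ax : a <=v x by apply/vsub_ge0; exact: partition_ge0 ps.
have [r [-> r1 r2]] := riesz_seq pt a0 ax.
have [q pq [sq rq]] := IH _ _ ps r2.
exists (map fst r ++ q); first by rewrite -(subrK a x) addrC; exact: partition_cat.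
rewrite variation_cat; split.
  by rewrite /variation big_cons; apply: vle_add => //; exact: variation_sum.
by apply: vle_trans (variation_split _) _; apply: vle_add => //; exact: vle_refl.
Qed.

End Subadditive.
End Partitions.

(** The extension sends [x] to [g x^+ - g x^-]; additivity makes the value
    independent of the way [x] is written as a difference of positive elements. *)
Lemma cone_extension (R : realType) (E F : banachLatticeType R) (g : E -> F) :
  (forall x y, 0 <=v x -> 0 <=v y -> g (x + y) = g x + g y) ->
  (forall (t : R) x, 0 < t -> 0 <=v x -> g (t *: x) = t *: g x) ->
  exists2 P : E -> F, linear P & forall x, 0 <=v x -> P x = g x.
Proof.
move=> gD gZ; pose P x := g (pospart x) - g (pospart (- x)).
have PB u v : 0 <=v u -> 0 <=v v -> P (u - v) = g u - g v.
  move=> u0 v0; rewrite /P; set w := u - v.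
  have : pospart w + v = u + pospart (- w).
    by rewrite -{1}(subrK (pospart (- w)) (pospart w)) posBN addrAC subrK.
  move=> /(congr1 g); rewrite !gD//; try exact: pos_ge0.
  move=> /(congr1 (fun z => z - g v - g (pospart (- w)))).
  by rewrite addrK [_ + _ - g v]addrAC addrK.
have g0 : g 0 = 0.
  by have := gD 0 0 (vle_refl _) (vle_refl _); rewrite addr0 => /(congr1 (fun y => y - g 0));
   rewrite subrr addrK.
exists P; last first.
  by move=> x x0; have := PB x 0 x0 (vle_refl _); rewrite subr0 g0 subr0.
have PD x y : P (x + y) = P x + P y.
  rewrite -{1}(posBN x) -{1}(posBN y) addrACA -opprD PB; try by apply: vadd_ge0; exact: pos_ge0.
  by rewrite !gD; try exact: pos_ge0; rewrite opprD addrACA.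
have PN x : P (- x) = - P x by rewrite /P opprK opprB.
have PZ (t : R) x : 0 < t -> P (t *: x) = t *: P x.
  by move=> t0; rewrite /P -scalerN !posZ ?ltW// !gZ//; try exact: pos_ge0; rewrite scalerBr.
have P0 : P 0 = 0 by rewrite /P oppr0 subrr.
move=> t x y; rewrite PD; congr (_ + _).
have [t0|/PZ//|->] := ltgtP t 0; last by rewrite !scale0r.
by rewrite -[t]opprK scaleNr PN PZ ?oppr_gt0// [RHS]scaleNr.
Qed.

(** * The positive part of an operator *)

Section PositivePart.
Context {R : realType} {E F : banachLatticeType R} (FAL : is_AL_space F).
Implicit Types (S T P U : E -> F) (x y : E).

Definition pos_variation T s : F := variation (fun z => pospart (T z)) s.

Lemma pos_variation_le T U s x : linear U -> op_le T U -> op_le 0 U ->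
  cone_partition s x -> pos_variation T s <=v U x.
Proof.
move=> lU TU U0 [s0 <-]; rewrite linear_map_sum//; apply: variation_le => z zs.
by apply: pos_le; [apply: U0|apply: TU]; exact: s0.
Qed.

(** Riesz-Kantorovich: the positive part of a linear map [T] with a positive
    majorant is the supremum of its positive variations.  They increase under
    refinement, hence converge in norm in the AL-space [F]. *)
Theorem riesz_kantorovich T S : linear T -> linear S ->
  op_le T S -> op_le 0 S ->
  exists P, [/\ linear P,
    forall s x, cone_partition s x -> pos_variation T s <=v P x,
    forall x (e : R), 0 <=v x -> 0 < e ->
      exists2 s, cone_partition s x & `|P x - pos_variation T s| < e
    & forall U, linear U -> op_le T U -> op_le 0 U -> op_le P U].
Proof.
move=> lT lS TS S0.
pose f z := pospart (T z).
have f0 : f 0 = 0 by rewrite /f linear_map_0// pos_id//; exact: vle_refl.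
have f_ge0 z : 0 <=v f z by exact: pos_ge0.
have fD x y : f (x + y) <=v f x + f y by rewrite /f linear_map_D//; exact: posD.
pose V := variation f.
have /choice[g gP] x : exists g : F, 0 <=v x ->
    [/\ forall s, cone_partition s x -> V s <=v g,
        forall u, (forall s, cone_partition s x -> V s <=v u) -> g <=v u
      & forall e : R, 0 < e -> exists2 s, cone_partition s x & `|g - V s| < e].
  have [x0|nx0] := pselect (0 <=v x); last by exists 0.
  have [||||g [g1 g2 g3]] := @AL_directed_sup _ _ FAL [set V s | s in [set s | cone_partition s x]] `|S x|.
  - by exists (V [:: x]), [:: x] => //=; exact: partition1.
  - by move=> _ [s _ <-]; exact: variation_ge0.
  - move=> _ [s ps <-]; apply: norm_mono; first exact: variation_ge0.
    exact: pos_variation_le.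
  - move=> _ _ [s ps <-] [t pt <-].
    have [r pr rP] := variation_directed f0 f_ge0 fD ps pt.
    by exists (V r) => //; exists r.
  exists g => _; split.
  - by move=> s ps; apply: g1; exists s.
  - by move=> u h; apply: g2 => _ [s ps <-]; exact: h.
  - by move=> e /g3[_ [s ps <-] gs]; exists s.
have [||P lP PE] := @cone_extension _ _ _ g.
- move=> x y x0 y0; have xy0 := vadd_ge0 x0 y0.
  have [gx gx_le _] := gP x x0; have [gy gy_le _] := gP y y0.
  have [gxy gxy_le _] := gP _ xy0.
  apply: vle_anti.
    apply: gxy_le => r pr.
    have [|r' [-> r1 r2]] := riesz_seq pr x0.
      by rewrite -[x in x <=v _]addr0; apply: vle_add => //; exact: vle_refl.
    apply: vle_trans (variation_split fD r') _; apply: vle_add; first exact: gx.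
    by apply: gy; rewrite addrAC subrr add0r in r2.
  apply/vleBr; apply: gx_le => s ps; apply/vleBr; rewrite addrC; apply/vleBr.
  apply: gy_le => t pt; apply/vleBr; rewrite addrC /V -variation_cat.
  exact/gxy/partition_cat.
- have g_ge (t : R) x : 0 < t -> 0 <=v x -> t *: g x <=v g (t *: x).
    move=> t0 x0; have tx0 := vle_scale_ge0 _ _ (ltW t0) x0.
    have [_ gx_le _] := gP x x0; have [gtx _ _] := gP _ tx0.
    rewrite -[X in _ <=v X](scalerKV (lt0r_neq0 t0)); apply: vle_scale (ltW t0) _.
    apply: gx_le => s [s0 sx]; rewrite -[V s](scalerK (lt0r_neq0 t0)).
    apply: vle_scale; first by rewrite invr_ge0 ltW.
    have -> : t *: V s = V (map ( *:%R t) s).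
      rewrite /V /variation big_map scaler_sumr; apply: eq_bigr => z _.
      by rewrite /f linear_map_Z// posZ// ltW.
    apply: gtx; split; last by rewrite big_map -scaler_sumr sx.
    by move=> _ /mapP[z /s0 z0 ->]; apply: vle_scale_ge0 => //; exact: ltW.
  move=> t x t0 x0; apply: vle_anti; last exact: g_ge.
  have tx0 := vle_scale_ge0 _ _ (ltW t0) x0.
  have := @g_ge t^-1 (t *: x); rewrite invr_gt0 scalerK ?lt0r_neq0// => /(_ t0 tx0).
  move=> /(vle_scale (ltW t0)); by rewrite scalerKV ?lt0r_neq0.
exists P; split => //.
- move=> s x ps; have x0 := partition_ge0 ps.
  by rewrite PE//; have [h _ _] := gP x x0; exact: h.
- by move=> x e x0; rewrite PE//; have [_ _ h] := gP x x0; exact: h.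
- move=> U lU TU U0 x x0; rewrite PE//; have [_ h _] := gP x x0; apply: h => s.
  exact: pos_variation_le.
Qed.

(** AM-compactness, on the intervals [[0, x]] only: those are the ones that Riesz
    decomposition cuts into pieces. *)
Definition AMcompact T := forall x, 0 <=v x ->
  totally_bounded (T @` [set y | 0 <=v y /\ y <=v x]).

(** [P y - (T y)^+] is the infimum of the positive operators [P] and [P - T],
    hence monotone in [y >= 0]. *)
Lemma pos_defect_mono T P x y : linear T -> linear P ->
  op_le 0 P -> op_le T P -> x <=v y ->
  P x - pospart (T x) <=v P y - pospart (T y).
Proof.
move=> lT lP P0 TP xy.
have defE z : P z - pospart (T z) = P z \wedge (P z - T z).
  by rewrite -[in pospart _](subKr (P z) (T z)) posB_meet subKr.
rewrite !defE; apply: vmeet_mono; first exact: positive_op_mono.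
have lPT : linear (fun z => P z - T z).
  move=> t u v; rewrite lP lT scalerBr opprD addrACA; congr (_ + _).
have PT0 : op_le 0 (fun z => P z - T z) by move=> z z0; apply/vsub_ge0/TP.
exact: positive_op_mono lPT PT0 xy.
Qed.

(** Any part [y] of [x] is cut along a partition [s] of [x] into parts [y i],
    and [P y] differs from the sum of the [(T (y i))^+] at most by the defect
    [P x - pos_variation T s]. *)
Lemma pos_part_near_sum T P s x : linear T -> linear P ->
  op_le 0 P -> op_le T P -> AMcompact T -> cone_partition s x ->
  exists2 B : set F, totally_bounded B &
    forall y, 0 <=v y -> y <=v x -> exists2 b, B b &
      0 <=v P y - b /\ P y - b <=v P x - pos_variation T s.
Proof.
move=> lT lP P0 TP cT; elim: s x => [|a s IH] x.
  move=> [_]; rewrite big_nil => <-; exists [set 0]; first exact: totally_bounded1.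
  move=> y y0 y1; have -> : y = 0 by exact: vle_anti.
  exists 0 => //; rewrite /pos_variation /variation big_nil linear_map_0// subr0.
  by split; exact: vle_refl.
move=> /partition_cons[a0 ps]; have [B tB BP] := IH _ ps.
exists [set c + b | c in pospart @` (T @` [set y | 0 <=v y /\ y <=v a]) & b in B].
  apply: totally_bounded_add => //; apply: (totally_bounded_lip ltr01) (cT a a0) => u v.
  by rewrite mul1r; exact: pos_lip.
move=> y y0 yx.
have [||y1 [y2 [-> y10 y1a y20 y2x]]] := @riesz2 _ _ y a (x - a) y0 a0.
- exact: partition_ge0 ps.
- by rewrite addrC subrK.
have [b Bb [b0 bx]] := BP y2 y20 y2x.
exists (pospart (T y1) + b); first by exists (pospart (T y1)); [exists (T y1) => //; exists y1|exists b].
rewrite (linear_map_D lP) opprD addrACA; split.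
  apply: vadd_ge0 => //; apply/vsub_ge0; apply: pos_le; [exact: P0|exact: TP].
have -> : P x - pos_variation T (a :: s) = (P a - pospart (T a)) + (P (x - a) - pos_variation T s).
  rewrite addrACA -(linear_map_D lP) [a + _]addrC subrK -opprD.
  by rewrite /pos_variation /variation big_cons.
by apply: vle_add => //; exact: pos_defect_mono.
Qed.

Lemma AMcompact_pos_part T P : linear T -> linear P -> op_le 0 P -> op_le T P ->
  (forall x (e : R), 0 <=v x -> 0 < e ->
    exists2 s, cone_partition s x & `|P x - pos_variation T s| < e) ->
  AMcompact T -> AMcompact P.
Proof.
move=> lT lP P0 TP PV cT x x0; apply: totally_bounded_approx => e e0.
have [s ps Ps] := PV x e x0 e0.
have [B tB BP] := pos_part_near_sum lT lP P0 TP cT ps.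
exists B => // _ [y [y0 yx] <-]; have [b Bb [b0 bP]] := BP y y0 yx.
by exists b => //; apply: le_lt_trans Ps; exact: norm_mono.
Qed.

End PositivePart.

(** * AM-un-compact operators and their norm *)

Section AMunOperators.
Context {R : realType} {E F : banachLatticeType R}.
Implicit Types (S T : E -> F) (x y : E).

Lemma linear_fun0 : linear (0 : E -> F).
Proof. by move=> t x y; change (0 = t *: (0 : F) + 0); rewrite scaler0 addr0. Qed.

Lemma linear_funD S T : linear S -> linear T -> linear (S + T).
Proof. by move=> lS lT t x y; rewrite !fctE lS lT scalerDr addrACA. Qed.

Lemma linear_funZ (c : R) T : linear T -> linear (c *: T).
Proof. by move=> lT t x y; rewrite !fctE lT scalerDr !scalerA mulrC. Qed.

Lemma AMcompact0 : AMcompact (0 : E -> F).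
Proof. by move=> x x0; apply: totally_bounded_sub (totally_bounded1 0) => _ [y _ <-]. Qed.

Lemma AMcompactD S T : AMcompact S -> AMcompact T -> AMcompact (S + T).
Proof.
move=> cS cT x x0; apply: totally_bounded_sub (totally_bounded_add (cS x x0) (cT x x0)).
by move=> _ [y xy <-]; exists (S y); [exists y|exists (T y) => //; exists y].
Qed.

Lemma AMcompactZ (c : R) T : AMcompact T -> AMcompact (c *: T).
Proof.
move=> cT x x0.
have c0 : 0 < `|c| + 1 by rewrite ltr_pwDr.
have lipc (u v : F) : `|c *: u - c *: v| <= (`|c| + 1) * `|u - v|.
  by rewrite -scalerBr normrZ ler_wpM2r// lerDl.
apply: totally_bounded_sub (totally_bounded_lip c0 lipc (cT x x0)).
by move=> _ [y xy <-]; exists (T y) => //; exists y.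
Qed.

Lemma AMcompact_limit T :
  (forall e : R, 0 < e -> exists2 S, AMcompact S & forall x, `|T x - S x| <= e * `|x|) ->
  AMcompact T.
Proof.
move=> TS x x0; apply: totally_bounded_approx => e e0.
have d0 : 0 < e / (`|x| + 1) by rewrite divr_gt0// ltr_pwDr.
have [S cS TSx] := TS _ d0; exists (S @` [set y | 0 <=v y /\ y <=v x]); first exact: cS.
move=> _ [y [y0 yx] <-]; exists (S y); first by exists y.
apply: le_lt_trans (TSx y) _; rewrite mulrAC ltr_pdivrMr ?ltr_pwDr// ltr_pM2l//.
by rewrite ltr_pwDr// norm_mono.
Qed.

Lemma AMcompact_order_interval T x : linear T -> AMcompact T -> 0 <=v x ->
  totally_bounded (T @` order_interval x).
Proof.
move=> lT cT x0.
have lipT (u v : F) : `|(u - T x) - (v - T x)| <= 1 * `|u - v|.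
  by rewrite mul1r opprB subrKA.
apply: totally_bounded_sub (totally_bounded_lip ltr01 lipT (cT _ (vadd_ge0 x0 x0))).
move=> _ [y [Nxy yx] <-]; exists (T (y + x)); last by rewrite linear_map_D// addrK.
exists (y + x) => //; split; last exact: vle_add2r.
by rewrite -(addNr x); exact: vle_add2r.
Qed.

(** On order intervals a dominated operator takes order bounded values, where
    un-compactness is total boundedness. *)
Lemma dominated_K_AMun S T : linear S -> linear T -> bounded_op S ->
  op_le 0 S -> op_le T S -> op_le (- T) S -> K_AMun E F T <-> AMcompact T.
Proof.
move=> lS lT bS S0 TS NTS; split=> [[_ _ cT] x x0|cT].
  have : totally_bounded (T @` order_interval x).
    apply: un_compact_totally_bounded (cT x x0) => _ [y [Nxy yx] <-].
    have Sy : S (modulus y) <=v S x.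
      apply: positive_op_mono => //; apply: modulus_le => //.
      by rewrite -[x]opprK; exact: vle_opp.
    have [TSy NTSy] := dominated_op_modulus y lS lT TS NTS; split.
      rewrite -[T y]opprK; apply: vle_opp; exact: vle_trans NTSy Sy.
    exact: vle_trans TSy Sy.
  by apply: totally_bounded_sub => _ [y [y0 yx] <-]; exists y => //; split => //;
    apply: vle_trans y0; rewrite -oppr0; exact: vle_opp.
split => //; last by move=> x x0; exact/totally_bounded_un_compact/AMcompact_order_interval.
by have [C CT] := dominated_op_bounded lS lT bS TS NTS; exact: linear_bounded_continuous_fun CT.
Qed.

Lemma Kpos_AMunP S :
  Kpos_AMun E F S <-> [/\ linear S, bounded_op S, AMcompact S & op_le 0 S].
Proof.
have SS := fun x (_ : 0 <=v x) => vle_refl (S x).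
split=> [[KS S0]|[lS bS cS S0]].
  have [lS cS _] := KS.
  have bS : bounded_op S by have [C _ CS] := linear_continuous_bounded lS cS; exists C.
  by split => //; apply/(dominated_K_AMun lS lS bS S0 SS (op_leN S0)).
by split => //; apply/(dominated_K_AMun lS lS bS S0 SS (op_leN S0)).
Qed.

Lemma Kr_AMunP T : Kr_AMun E F T <->
  [/\ linear T, AMcompact T & exists S, [/\ Kpos_AMun E F S, op_le T S & op_le (- T) S]].
Proof.
split=> [[KT [S [KS TS NTS]]]|[lT cT [S [KS TS NTS]]]].
  have [lS bS cS S0] := (Kpos_AMunP S).1 KS; have [lT _ _] := KT.
  by split; [|exact/(dominated_K_AMun lS lT bS S0 TS NTS)|exists S].
have [lS bS cS S0] := (Kpos_AMunP S).1 KS.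
by split; [exact/(dominated_K_AMun lS lT bS S0 TS NTS)|exists S].
Qed.

Lemma op_norm_eq0 T : linear T -> bounded_op T -> op_norm T = 0 -> T = 0.
Proof.
move=> lT bT T0; apply/funext => x; apply/eqP; rewrite -normr_eq0 eq_le normr_ge0 andbT.
by have := op_norm_bound x lT bT; rewrite T0 mul0r.
Qed.

Lemma bounded_opD S T : bounded_op S -> bounded_op T -> bounded_op (S + T).
Proof.
move=> [C CS] [D DT]; exists (C + D) => x.
by apply: le_trans (ler_normD _ _) _; rewrite mulrDl lerD.
Qed.

Lemma bounded_opZ (c : R) T : bounded_op T -> bounded_op (c *: T).
Proof.
move=> [C CT]; exists (`|c| * C) => x.
by rewrite normrZ -mulrA ler_wpM2l.
Qed.

Lemma op_normD S T : bounded_op S -> bounded_op T ->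
  op_norm (S + T) <= op_norm S + op_norm T.
Proof.
move=> bS bT; apply: op_norm_le => x x1.
by apply: le_trans (ler_normD _ _) _; rewrite lerD// op_norm_ub.
Qed.

Lemma op_normZ (c : R) T : bounded_op T -> op_norm (c *: T) <= `|c| * op_norm T.
Proof.
move=> bT; apply: op_norm_le => x x1.
by rewrite normrZ ler_wpM2l// op_norm_ub.
Qed.

Lemma Kpos_AMun0 : Kpos_AMun E F (0 : E -> F).
Proof.
apply/Kpos_AMunP; split; [exact: linear_fun0|exists 0|exact: AMcompact0|].
  by move=> x; rewrite normr0 mul0r.
by move=> x _; exact: vle_refl.
Qed.

Lemma Kpos_AMunD S T : Kpos_AMun E F S -> Kpos_AMun E F T -> Kpos_AMun E F (S + T).
Proof.
move=> /Kpos_AMunP[lS bS cS S0] /Kpos_AMunP[lT bT cT T0]; apply/Kpos_AMunP; split.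
- exact: linear_funD.
- exact: bounded_opD.
- exact: AMcompactD.
- by move=> x x0; apply: vadd_ge0; [exact: S0|exact: T0].
Qed.

Lemma Kpos_AMunZ (c : R) S : 0 <= c -> Kpos_AMun E F S -> Kpos_AMun E F (c *: S).
Proof.
move=> c0 /Kpos_AMunP[lS bS cS S0]; apply/Kpos_AMunP; split.
- exact: linear_funZ.
- exact: bounded_opZ.
- exact: AMcompactZ.
- by move=> x x0; apply: vle_scale_ge0 => //; exact: S0.
Qed.

Lemma Kpos_Kr_AMun S : Kpos_AMun E F S -> Kr_AMun E F S.
Proof.
move=> KS; split; first exact: KS.1.
exists S; split => //; first by move=> x _; exact: vle_refl.
by apply: op_leN; exact: KS.2.
Qed.

Lemma AMun_dominants_scale (c : R) T S :
  AMun_dominants T S -> AMun_dominants (c *: T) (`|c| *: S).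
Proof.
move=> [KS TS NTS]; split; first exact: Kpos_AMunZ.
  move=> x x0 /=; have [c0|c0] := leP 0 c.
    by rewrite ger0_norm//; apply: vle_scale => //; exact: TS.
  rewrite ltr0_norm// -[c in X in X <=v _]opprK scaleNr -scalerN.
  by apply: vle_scale; [rewrite oppr_ge0 ltW|exact: NTS].
move=> x x0 /=; have [c0|c0] := leP 0 c.
  by rewrite ger0_norm// -scalerN; apply: vle_scale => //; exact: NTS.
by rewrite ltr0_norm// -scaleNr; apply: vle_scale; [rewrite oppr_ge0 ltW|exact: TS].
Qed.

Lemma AMun_dominantsD T T' S S' : AMun_dominants T S -> AMun_dominants T' S' ->
  AMun_dominants (T + T') (S + S').
Proof.
move=> [KS TS NTS] [KS' TS' NTS']; split; first exact: Kpos_AMunD.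
  by move=> x x0; apply: vle_add; [exact: TS|exact: TS'].
by move=> x x0 /=; rewrite opprD; apply: vle_add; [exact: NTS|exact: NTS'].
Qed.

Lemma Kr_AMunZ (c : R) T : Kr_AMun E F T -> Kr_AMun E F (c *: T).
Proof.
move=> /Kr_AMunP[lT cT [S TS]]; apply/Kr_AMunP; split.
- exact: linear_funZ.
- exact: AMcompactZ.
- by exists (`|c| *: S); exact: AMun_dominants_scale.
Qed.

Lemma Kr_AMunD S T : Kr_AMun E F S -> Kr_AMun E F T -> Kr_AMun E F (S + T).
Proof.
move=> /Kr_AMunP[lS cS [S' SS']] /Kr_AMunP[lT cT [T' TT']]; apply/Kr_AMunP; split.
- exact: linear_funD.
- exact: AMcompactD.
- by exists (S' + T'); exact: AMun_dominantsD.
Qed.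

Lemma AMun_norm_ge0 T : 0 <= AMun_norm T.
Proof.
have [T0|/set0P[S TS]] := eqVneq (AMun_dominants T) set0.
  by rewrite /AMun_norm T0 image_set0 inf0.
apply: lb_le_inf; first by exists (op_norm S), S.
by move=> _ [S' [/Kpos_AMunP[_ bS _ _] _ _] <-]; exact: op_norm_ge0.
Qed.

Lemma AMun_norm_le T S : AMun_dominants T S -> AMun_norm T <= op_norm S.
Proof.
move=> TS; apply: ge_inf; last by exists S.
by exists 0 => _ [S' [/Kpos_AMunP[_ bS _ _] _ _] <-]; exact: op_norm_ge0.
Qed.

Lemma AMun_norm_least T M : AMun_dominants T M ->
  (forall S, AMun_dominants T S -> op_le M S) -> AMun_norm T = op_norm M.
Proof.
move=> TM Mle; apply/eqP; rewrite eq_le AMun_norm_le//=.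
apply: lb_le_inf; first by exists (op_norm M), M.
move=> _ [S TS <-]; have MS := Mle S TS.
have [/Kpos_AMunP[lM bM cM M0] _ _] := TM; have [/Kpos_AMunP[lS bS cS S0] _ _] := TS.
apply: op_norm_mono => // x x0; apply: vle_trans (MS x x0); exact: op_leN.
Qed.

Lemma AMun_norm_pos T : Kpos_AMun E F T -> AMun_norm T = op_norm T.
Proof.
move=> KT; apply: AMun_norm_least; last by move=> S [].
split => //; first by move=> x _; exact: vle_refl.
by apply: op_leN; exact: KT.2.
Qed.

(** The positive part is dominated by any positive majorant of [T], which makes it
    bounded. *)
Lemma Kr_AMun_pos_part (FAL : is_AL_space F) T : Kr_AMun E F T ->
  exists P, [/\ Kpos_AMun E F P, op_le T P &
    forall U, linear U -> op_le T U -> op_le 0 U -> op_le P U].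
Proof.
move=> /Kr_AMunP[lT cT [S [/Kpos_AMunP[lS bS cS S0] TS NTS]]].
have [P [lP VP PV Ple]] := riesz_kantorovich FAL lT lS TS S0.
have TP x : 0 <=v x -> pospart (T x) <=v P x.
  move=> x0; have := VP _ _ (partition1 x0).
  by rewrite /pos_variation /variation big_seq1.
have P0 : op_le 0 P by move=> x /TP; apply: vle_trans; exact: pos_ge0.
have {}TP : op_le T P by move=> x /TP; apply: vle_trans; exact: pos_ge.
exists P; split => //; apply/Kpos_AMunP; split => //.
  by apply: dominated_op_bounded lS lP bS (Ple _ lS TS S0) _ => x x0;
    apply: vle_trans (S0 x x0); rewrite -oppr0; apply/vle_opp/P0.
exact: AMcompact_pos_part lT lP P0 TP PV cT.
Qed.

End AMunOperators.

(** * The vector lattice of regular AM-un-compact operators *)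

Section CauchyOperators.
Context {R : realType} {E F : banachLatticeType R}.
Implicit Types (A : nat -> E -> F) (x : E).

Lemma half_pow_small (C e : R) : 0 < e -> exists n : nat, C * 2^-1 ^+ n < e.
Proof.
move=> e0; pose n := Num.truncn (C / e); exists n.
rewrite exprVn ltr_pdivrMr ?exprn_gt0// mulrC -ltr_pdivrMr//.
apply: lt_le_trans (truncnS_gt _) _; rewrite -natrX ler_nat.
exact: ltn_expl.
Qed.

Lemma op_limit A (C : R) : (forall n, linear (A n)) ->
  (forall n m x, (n <= m)%N -> `|A m x - A n x| <= C * 2^-1 ^+ n * `|x|) ->
  exists L, [/\ linear L, forall n x, `|L x - A n x| <= C * 2^-1 ^+ n * `|x|
    & forall x, A ^~ x @ \oo --> L x].
Proof.
move=> lA CA.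
have cvgA x : cvg (A ^~ x @ \oo).
  apply: cauchy_cvg; apply: cauchy_exP => e e0.
  have [n nP] := half_pow_small (C * `|x|) e0; exists (A n x), n => // m /= nm.
  rewrite -ball_normE /= distrC; apply: le_lt_trans (CA _ _ x nm) _.
  by rewrite mulrAC.
pose L x := lim (A ^~ x @ \oo).
have AL x : A ^~ x @ \oo --> L x by exact: cvgA.
exists L; split => //.
  move=> t x y; apply: (@cvg_unique _ (@norm_hausdorff _ _) ((A ^~ (t *: x + y)) @ \oo)); first exact: AL.
  have -> : A ^~ (t *: x + y) = (fun n => t *: A n x + A n y).
    by apply/funext => n; rewrite lA.
  by apply: cvgD; [apply: cvgZl_tmp|]; exact: AL.
move=> n x; apply/ler_addgt0Pr => e e0.
have /cvgrPdist_le/(_ e e0)[m _ mP] := AL x.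
have nk : (n <= maxn n m)%N by exact: leq_maxl.
have mk : (m <= maxn n m)%N by exact: leq_maxr.
rewrite -(subrKA (A (maxn n m) x)) addrC; apply: le_trans (ler_normD _ _) _.
by rewrite lerD//; [exact: CA|exact: mP].
Qed.

Lemma vle_cvg (a b : nat -> F) (la lb : F) (n0 : nat) :
  a @ \oo --> la -> b @ \oo --> lb ->
  (forall n, (n0 <= n)%N -> a n <=v b n) -> la <=v lb.
Proof.
move=> aP bP ab; apply/vsub_ge0/vge0_closed => e e0.
have ba : (fun n => b n - a n) @ \oo --> lb - la by exact: cvgB.
have /cvgrPdist_le/(_ e e0)[m _ mP] := ba.
exists (b (maxn m n0) - a (maxn m n0)).
  by apply/vsub_ge0/ab; exact: leq_maxr.
by apply: mP; exact: leq_maxl.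
Qed.

End CauchyOperators.

Section RegularAMun.
Context {R : realType} {E F : banachLatticeType R}.
Implicit Types (S T : E -> F) (x y : E).

(** The regular operators as a boolean predicate, through which the subspace
    inherits the linear structure of the space of functions. *)
Definition Kr_pred : {pred E -> F} := [pred T | `[< Kr_AMun E F T >]].

Lemma Kr_predP T : reflect (Kr_AMun E F T) (T \in Kr_pred).
Proof. exact: asboolP. Qed.

Lemma Kr_submod_closed : submod_closed Kr_pred.
Proof.
split; first by apply/Kr_predP; exact: Kpos_Kr_AMun (Kpos_AMun0).
move=> c S T /Kr_predP KS /Kr_predP KT; apply/Kr_predP.
by apply: Kr_AMunD => //; exact: Kr_AMunZ.
Qed.

HB.instance Definition _ := GRing.isSubmodClosed.Build R (E -> F) Kr_pred
  Kr_submod_closed.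

(** The hypothesis on [F] is a parameter of the type so that the lattice
    operations, whose existence rests on it, can be canonical. *)
Record regular_AMun (FAL : is_AL_space F) :=
  RegularAMun { regular_op : E -> F; _ : regular_op \in Kr_pred }.

Context (FAL : is_AL_space F).
Local Notation X := (regular_AMun FAL).

HB.instance Definition _ := [isSub for @regular_op FAL].
HB.instance Definition _ := [Choice of X by <:].
HB.instance Definition _ := [SubChoice_isSubLmodule of X by <:].

Lemma regularP (T : X) : Kr_AMun E F (val T).
Proof. exact/Kr_predP/valP. Qed.

Lemma regular_linear (T : X) : linear (val T).
Proof. by have /Kr_AMunP[] := regularP T. Qed.

Definition regular (T : E -> F) (KT : Kr_AMun E F T) : X :=
  Sub T (introT (Kr_predP T) KT).

Lemma regularE T (KT : Kr_AMun E F T) : val (regular KT) = T.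
Proof. exact: SubK. Qed.

Implicit Types u v w : X.

Definition regular_le u v := op_le (val u) (val v).

Lemma regular_le_refl u : regular_le u u.
Proof. by move=> x _; exact: vle_refl. Qed.

Lemma regular_le_anti u v : regular_le u v -> regular_le v u -> u = v.
Proof.
move=> uv vu; apply: val_inj; apply/funext => x.
have uvpos z : 0 <=v z -> val u z = val v z by move=> z0; apply: vle_anti; [exact: uv|exact: vu].
rewrite -(posBN x) !linear_map_B; try exact: regular_linear.
by rewrite !uvpos//; exact: pos_ge0.
Qed.

Lemma regular_le_trans v u w : regular_le u v -> regular_le v w -> regular_le u w.
Proof. by move=> uv vw x x0; apply: vle_trans (uv x x0) (vw x x0). Qed.

Lemma regular_le_add2r w u v : regular_le u v -> regular_le (u + w) (v + w).
Proof. by move=> uv x x0; apply: vle_add2r; exact: uv. Qed.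

Lemma regular_le_scale (a : R) u : 0 <= a -> regular_le 0 u -> regular_le 0 (a *: u).
Proof. by move=> a0 u0 x x0; apply: vle_scale_ge0 => //; exact: u0. Qed.

Lemma regular_le_opp u v : regular_le u v -> regular_le (- v) (- u).
Proof. by move=> uv x x0; apply: vle_opp; exact: uv. Qed.

(** The join is [v + (u - v)^+]. *)
Lemma regular_join_exists u v : exists w, forall z,
  regular_le w z <-> regular_le u z /\ regular_le v z.
Proof.
have [P [KP uvP Ple]] := Kr_AMun_pos_part FAL (regularP (u - v)).
have P0 := KP.2.
exists (v + regular (Kpos_Kr_AMun KP)) => z; split.
  move=> wz; split=> x x0; apply: vle_trans (wz x x0).
    rewrite -[X in X <=v _](subrK (val v x)) [X in _ <=v X]addrC.
    by apply: vle_add2r; exact: uvP.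
  rewrite -[X in X <=v _]addr0; apply: vle_add (vle_refl _) _; exact: P0.
move=> [uz vz] x x0.
change (val v x + P x <=v val z x); rewrite addrC; apply/vleBr.
apply: (Ple (val (z - v)) (regular_linear _) _ _ x x0) => {x x0} x x0.
  by apply: vle_add2r; exact: uz.
by apply/vsub_ge0; exact: vz.
Qed.

Definition regular_join u v := projT1 (cid (regular_join_exists u v)).

Lemma regular_joinP u v z :
  regular_le (regular_join u v) z <-> regular_le u z /\ regular_le v z.
Proof. by rewrite /regular_join; case: cid => w /= ->. Qed.

Definition regular_meet u v := - regular_join (- u) (- v).

Lemma regular_meetP u v z :
  regular_le z (regular_meet u v) <-> regular_le z u /\ regular_le z v.
Proof.
have oppE a b : regular_le a (- b) <-> regular_le b (- a).
  by split=> /regular_le_opp; rewrite opprK.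
rewrite oppE regular_joinP; split=> -[zu zv].
  by split; rewrite -[z]opprK -[X in regular_le _ X]opprK; exact: regular_le_opp.
by split; exact: regular_le_opp.
Qed.

Definition regular_modulus u := regular_join u (- u).

(** The modulus is the least dominating operator, so that the infimum defining the
    norm is attained at it. *)
Lemma regular_modulus_dominates u :
  AMun_dominants (val u) (val (regular_modulus u)).
Proof.
have [uM NuM] := (regular_joinP u (- u) (regular_modulus u)).1 (@regular_le_refl _).
split => //; split; first exact: (regularP _).1.
by move=> x x0; apply: vle_trans (modulus_ge0 (val u x)) (modulus_le _ _); [exact: uM|exact: NuM].
Qed.

Lemma regular_modulus_least u S : AMun_dominants (val u) S ->
  op_le (val (regular_modulus u)) S.
Proof.
move=> [KS uS NuS].
by apply: ((regular_joinP u (- u) (regular (Kpos_Kr_AMun KS))).2 (conj uS NuS)).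
Qed.

Definition regular_norm u : R := AMun_norm (val u).

Lemma regular_normE u : regular_norm u = op_norm (val (regular_modulus u)).
Proof.
by apply: AMun_norm_least; [exact: regular_modulus_dominates|exact: regular_modulus_least].
Qed.

Lemma regular_normD u v : regular_norm (u + v) <= regular_norm u + regular_norm v.
Proof.
rewrite (regular_normE u) (regular_normE v).
have uM := regular_modulus_dominates u; have vM := regular_modulus_dominates v.
apply: le_trans (AMun_norm_le (AMun_dominantsD uM vM)) _.
have [/Kpos_AMunP[_ bu _ _] _ _] := uM; have [/Kpos_AMunP[_ bv _ _] _ _] := vM.
exact: op_normD.
Qed.

Lemma regular_normZ_le (c : R) u : regular_norm (c *: u) <= `|c| * regular_norm u.
Proof.
have uM := regular_modulus_dominates u; rewrite (regular_normE u).
have := AMun_norm_le (AMun_dominants_scale c uM); move=> /le_trans; apply.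
have [/Kpos_AMunP[_ bu _ _] _ _] := uM.
by have := op_normZ `|c| bu; rewrite normr_id.
Qed.

Lemma regular_norm_ge0 u : 0 <= regular_norm u.
Proof. exact: AMun_norm_ge0. Qed.

Lemma regular_normZ (c : R) u : regular_norm (c *: u) = `|c| * regular_norm u.
Proof.
apply/eqP; rewrite eq_le regular_normZ_le/=.
have [->|c0] := eqVneq c 0; first by rewrite normr0 mul0r regular_norm_ge0.
rewrite -ler_pdivlMl ?normr_gt0// -normfV.
by rewrite -{1}[u](scalerK c0); exact: regular_normZ_le.
Qed.

Lemma regular_norm_eq0 u : regular_norm u = 0 -> u = 0.
Proof.
rewrite regular_normE => M0.
have [/Kpos_AMunP[lM bM _ _] uM NuM] := regular_modulus_dominates u.
have MZ := op_norm_eq0 lM bM M0.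
apply: val_inj; apply/funext => x; apply/eqP; rewrite -normr_eq0 eq_le normr_ge0 andbT.
have := dominated_op_bound x lM (regular_linear u) uM NuM.
by rewrite MZ normr0.
Qed.

HB.instance Definition _ := Lmodule_isNormed.Build R X
  regular_normD regular_normZ regular_norm_eq0.

Lemma regular_norm_solid u v :
  regular_le (regular_join u (- u)) (regular_join v (- v)) -> `|u| <= `|v|.
Proof.
move=> uv; change (regular_norm u <= regular_norm v); rewrite !regular_normE.
have [/Kpos_AMunP[lu bu _ u0] _ _] := regular_modulus_dominates u.
have [/Kpos_AMunP[lv bv _ v0] _ _] := regular_modulus_dominates v.
apply: op_norm_mono => // x x0; apply: vle_trans (uv x x0); exact: op_leN.
Qed.

End RegularAMun.

(** * Completeness and additivity of the norm *)

Section Completeness.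
Context {R : realType} {E F : banachLatticeType R} (FAL : is_AL_space F).
Local Notation X := (regular_AMun (E := E) FAL).
Implicit Types u v w : X.

(** The moduli [|T n.+1 - T n|] form a summable series of positive operators,
    whose tails dominate the differences between [T n] and the pointwise
    limit of [T]. *)
Lemma regular_fast_cauchy (T : nat -> X) :
  (forall n, `|T n.+1 - T n| <= 2 * 2^-1 ^+ n) ->
  exists u : X, forall n, `|u - T n| <= 4 * 2^-1 ^+ n.
Proof.
move=> TC; pose D n := regular_modulus (T n.+1 - T n).
have DK n : Kpos_AMun E F (val (D n)).
  by have [] := regular_modulus_dominates (T n.+1 - T n).
have Dnorm n x : `|val (D n) x| <= 2 * 2^-1 ^+ n * `|x|.
  have /Kpos_AMunP[lD bD _ _] := DK n; apply: le_trans (op_norm_bound x lD bD) _.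
  by apply: ler_wpM2r => //; rewrite -regular_normE; exact: TC.
pose P n : E -> F := val (\sum_(k < n) D k).
have PS n : P n.+1 = P n + val (D n) by rewrite /P big_ord_recr.
pose t n : E -> F := val (T n).
have lt_ n : linear (t n) by exact: regular_linear.
have lP n : linear (P n) by exact: regular_linear.
(* [4 * 2^-n] is the sum of the bounds [2 * 2^-k] for [k >= n] *)
have half n : 4 * 2^-1 ^+ n = 2 * 2^-1 ^+ n + 4 * 2^-1 ^+ n.+1 :> R.
  by rewrite exprS; lra.
have tail n m x : (n <= m)%N -> [/\ `|P m x - P n x| <= 4 * 2^-1 ^+ n * `|x|,
    0 <=v x -> 0 <=v P m x - P n x,
    0 <=v x -> t m x - t n x <=v P m x - P n x
    & 0 <=v x -> - (t m x - t n x) <=v P m x - P n x].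
  move=> /subnK <-; move: (m - n)%N => {m} k; elim: k n => [|k IH] n.
    rewrite add0n !subrr oppr0; split; try (by move=> _; exact: vle_refl).
    by rewrite normr0 mulr_ge0// mulr_ge0// exprn_ge0// invr_ge0.
  have [b1 b2 b3 b4] := IH n.+1; rewrite addSnnS.
  have telescope (f : nat -> F) : f (k + n.+1)%N - f n = (f (k + n.+1)%N - f n.+1) + (f n.+1 - f n).
    by rewrite subrKA.
  have PD : P n.+1 x - P n x = val (D n) x by rewrite PS !fctE addrAC subrr add0r.
  rewrite (telescope (P ^~ x)) (telescope (t ^~ x)) PD.
  have [_ d1 d2] := regular_modulus_dominates (T n.+1 - T n).
  split.
  - apply: le_trans (ler_normD _ _) _; rewrite half addrC mulrDl.
    by apply: lerD; [exact: Dnorm|exact: b1].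
  - by move=> x0; apply: vadd_ge0; [exact: b2|exact: (DK n).2].
  - by move=> x0; apply: vle_add; [exact: b3|exact: d1].
  - by move=> x0; rewrite opprD; apply: vle_add; [exact: b4|exact: d2].
have [Q [lQ QP cQ]] := op_limit lP (fun n m x nm => let: And4 h _ _ _ := tail n m x nm in h).
have sub_lin (A B : E -> F) : linear A -> linear B -> linear (A - B).
  by move=> lA lB; rewrite -scaleN1r; apply: linear_funD => //; exact: linear_funZ.
have t_bound n m x : (n <= m)%N -> `|t m x - t n x| <= 4 * 2^-1 ^+ n * `|x|.
  move=> nm; have [h _ _ _] := tail n m (modulus x) nm; rewrite norm_modulus in h.
  apply: le_trans h.
  apply: (@dominated_op_bound _ _ _ (P m - P n) (t m - t n)); [exact: sub_lin|exact: sub_lin| |].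
    by move=> y y0; have [_ _ k _] := tail n m y nm; exact: k.
  by move=> y y0; have [_ _ _ k] := tail n m y nm; exact: k.
have [L [lL LT cL]] := op_limit lt_ t_bound.
have small (e : R) : 0 < e -> exists n : nat, 4 * 2^-1 ^+ n <= e.
  by move=> e0; have [n /ltW ne] := half_pow_small 4 e0; exists n.
have cpt_limit (A : nat -> E -> F) (B : E -> F) : (forall n, AMcompact (A n)) ->
    (forall n x, `|B x - A n x| <= 4 * 2^-1 ^+ n * `|x|) -> AMcompact B.
  move=> cA BA; apply: AMcompact_limit => e e0; have [n ne] := small e e0.
  by exists (A n) => // x; apply: le_trans (BA n x) _; exact: ler_wpM2r.
have cP n : AMcompact (P n) by have /Kr_AMunP[] := regularP (\sum_(k < n) D k).
have ct n : AMcompact (t n) by have /Kr_AMunP[] := regularP (T n).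
have cQ_ : AMcompact Q by exact: cpt_limit cP QP.
have cL_ : AMcompact L by exact: cpt_limit ct LT.
have sub_cpt (A B : E -> F) : AMcompact A -> AMcompact B -> AMcompact (A - B).
  by move=> cA cB; rewrite -scaleN1r; apply: AMcompactD => //; exact: AMcompactZ.
have LQ n : AMun_dominants (L - t n) (Q - P n).
  have cst (y : F) : (fun _ : nat => y) @ \oo --> y by exact: cvg_cst.
  split.
  - apply/Kpos_AMunP; split; [exact: sub_lin|by exists (4 * 2^-1 ^+ n) => x; exact: QP|exact: sub_cpt|].
    move=> x x0; apply: (vle_cvg (n0 := n) (cst 0) (cvgB (cQ x) (cst (P n x)))) => m nm.
    by have [_ h _ _] := tail n m x nm; exact: h.
  - move=> x x0; apply: (vle_cvg (n0 := n) (cvgB (cL x) (cst (t n x))) (cvgB (cQ x) (cst (P n x)))) => m nm.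
    by have [_ _ h _] := tail n m x nm; exact: h.
  - move=> x x0; apply: (vle_cvg (n0 := n) (cvgN (cvgB (cL x) (cst (t n x)))) (cvgB (cQ x) (cst (P n x)))) => m nm.
    by have [_ _ _ h] := tail n m x nm; exact: h.
have KL : Kr_AMun E F L.
  have -> : L = (L - t 0%N) + t 0%N by rewrite subrK.
  apply: Kr_AMunD; last exact: regularP.
  by apply/Kr_AMunP; split; [exact: sub_lin|exact: sub_cpt|exists (Q - P 0%N); exact: LQ].
exists (regular FAL KL) => n.
apply: le_trans (AMun_norm_le (LQ n)) _.
apply: op_norm_le => x x1.
apply: le_trans (QP n x) _; rewrite -[leRHS]mulr1; exact: ler_wpM2l.
Qed.

(** The centres of balls of radius [2^-n] that belong to a Cauchy filter form a
    sequence that converges fast enough. *)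
Lemma regular_complete (U : set_system X) : ProperFilter U -> cauchy U -> cvg U.
Proof.
move=> UF /cauchyP UC.
have pow0 n : 0 < 2^-1 ^+ n :> R by rewrite exprn_gt0// invr_gt0.
have /choice[T TU] n : exists T : X, U (ball T (2^-1 ^+ n : R)) by exact: UC.
have [n|u uT] := @regular_fast_cauchy T.
  have [v [+ +]] := @filter_ex _ U _ _ (filterI (TU n.+1) (TU n)).
  rewrite -ball_normE /= => h1; rewrite distrC => h2.
  rewrite -(subrKA v); apply: le_trans (ler_normD _ _) _.
  by have := pow0 n; rewrite exprS in h1; lra.
apply/cvg_ex; exists u; apply/cvgrPdist_le => e e0.
have [n nP] := half_pow_small 5 e0; apply: filterS (TU n) => v.
rewrite -ball_normE /= => h; rewrite -(subrKA (T n)).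
by apply: le_trans (ler_normD _ _) _; have := uT n; lra.
Qed.

HB.instance Definition _ := Uniform_isComplete.Build X regular_complete.

HB.instance Definition _ := isBanachLattice.Build R X
  (@regular_le_refl _ _ _ _) (@regular_le_anti _ _ _ _) (@regular_le_trans _ _ _ _)
  (@regular_joinP _ _ _ _) (@regular_meetP _ _ _ _) (@regular_le_add2r _ _ _ _)
  (@regular_le_scale _ _ _ _) (@regular_norm_solid _ _ _ _).

(** For [x] and [y] in the unit ball, [|S x|] and [|T y|] do not decrease when both
    points are replaced by the supremum of their moduli, which stays in the ball
    of an AM-space; at this common point the norm of the AL-space [F] adds up. *)
Lemma op_norm_AL (EAM : is_AM_space E) (S T : E -> F) :
  Kpos_AMun E F S -> Kpos_AMun E F T -> op_norm (S + T) = op_norm S + op_norm T.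
Proof.
move=> /Kpos_AMunP[lS bS _ S0] /Kpos_AMunP[lT bT _ T0].
have SS : op_le S S by move=> x _; exact: vle_refl.
have TT : op_le T T by move=> x _; exact: vle_refl.
apply/eqP; rewrite eq_le op_normD//=.
rewrite -lerBrDr; apply: op_norm_le => x x1.
rewrite lerBrDr -lerBrDl; apply: op_norm_le => y y1; rewrite lerBrDl.
pose z := modulus x \vee modulus y.
have z0 : 0 <=v z by apply: vle_trans (modulus_ge0 x) (vjoin_l _ _).
have z1 : `|z| <= 1.
  by rewrite EAM ?modulus_ge0// ?norm_modulus ?ge_max ?x1//; exact: modulus_ge0.
have bST := bounded_opD bS bT.
apply: le_trans (op_norm_ub bST z1).
change (`|S x| + `|T y| <= `|S z + T z|); rewrite FAL; [|exact: S0|exact: T0].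
apply: lerD.
  apply: le_trans (dominated_op_bound x lS lS SS (op_leN S0)) _.
  apply: norm_mono; first exact/S0/modulus_ge0.
  by apply: positive_op_mono => //; exact: vjoin_l.
apply: le_trans (dominated_op_bound y lT lT TT (op_leN T0)) _.
apply: norm_mono; first exact/T0/modulus_ge0.
by apply: positive_op_mono => //; exact: vjoin_r.
Qed.

Lemma regular_AL_space : is_AM_space E -> is_AL_space X.
Proof.
move=> EAM u v u0 v0.
change (AMun_norm (val u + val v) = AMun_norm (val u) + AMun_norm (val v)).
have Ku : Kpos_AMun E F (val u) by split; [exact: (regularP u).1|exact: u0].
have Kv : Kpos_AMun E F (val v) by split; [exact: (regularP v).1|exact: v0].
by rewrite !AMun_norm_pos ?op_norm_AL//; exact: Kpos_AMunD.
Qed.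

Lemma Kr_AMun_is_AL_space : is_AM_space E ->
  is_AL_space_under (Kr_AMun E F) (@op_le R E F) (@AMun_norm R E F).
Proof.
move=> EAM; exists X, (val : {linear X -> (E -> F)}); split => //.
- apply/seteqP; split=> [_ [u _ <-]|T KT]; first exact: regularP.
  by exists (regular FAL KT) => //; rewrite regularE.
- exact: regular_AL_space.
Qed.

End Completeness.

(** * Rank one operators and the converse *)

Section Converse.
Context {R : realType} {E F : banachLatticeType R}.
Implicit Types (x z : E) (y : F).

(** The positive functionals of norm at most one: below [|x^+|], a functional is
    nonpositive on [- E_+] and bounded by the norm. *)
Definition positive_contraction (phi : E -> R) :=
  [/\ forall u v, phi (u + v) = phi u + phi v,
      forall (t : R) u, phi (t *: u) = t * phi u
    & forall u, phi u <= `|pospart u|].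

Section PositiveContraction.
Context (phi : E -> R) (Pphi : positive_contraction phi).

Lemma positive_contraction_opp u : phi (- u) = - phi u.
Proof. by case: Pphi => _ phiZ _; rewrite -scaleN1r phiZ mulN1r. Qed.

Lemma positive_contraction_ge0 u : 0 <=v u -> 0 <= phi u.
Proof.
case: Pphi => _ _ phi_le u0; rewrite -oppr_le0 -positive_contraction_opp.
apply: le_trans (phi_le _) _; rewrite pos_npos ?normr0//.
by rewrite -oppr0; exact: vle_opp.
Qed.

Lemma positive_contraction_norm u : `|phi u| <= `|u|.
Proof.
have h v : phi v <= `|v| by case: Pphi => _ _ /(_ v) /le_trans; apply; exact: norm_pos_le.
rewrite ler_norml h andbT lerNl -positive_contraction_opp.
by apply: le_trans (h _) _; rewrite normrN.
Qed.

Definition rank_one y : E -> F := fun x => phi x *: y.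

Lemma rank_one_le y x : `|rank_one y x| <= `|y| * `|x|.
Proof. by rewrite normrZ mulrC ler_wpM2l// positive_contraction_norm. Qed.

Lemma rank_one_Kpos y : 0 <=v y -> Kpos_AMun E F (rank_one y).
Proof.
move=> y0; apply/Kpos_AMunP; case: Pphi => phiD phiZ _; split.
- by move=> t u v; rewrite /rank_one phiD phiZ scalerDl scalerA.
- by exists `|y| => x; exact: rank_one_le.
- move=> x x0; apply: totally_bounded_sub (totally_bounded_line (phi x) y) => _ [u [u0 ux] <-].
  exists (phi u) => //=; rewrite ger0_norm ?positive_contraction_ge0//.
  move: ux => /vsub_ge0 /positive_contraction_ge0.
  by rewrite phiD positive_contraction_opp subr_ge0.
- by move=> x x0; apply: vle_scale_ge0 => //; exact: positive_contraction_ge0.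
Qed.

End PositiveContraction.

Lemma norm_pos_sublinear : sublinear (fun u : E => `|pospart u|).
Proof.
split=> [u v|t u t0]; last by rewrite posZ// normrZ ger0_norm.
apply: le_trans (ler_normD _ _).
by apply: norm_mono; [exact: pos_ge0|exact: posD].
Qed.

Lemma vjoinZ (t : R) u v : 0 <= t -> (t *: u) \vee (t *: v) = t *: (u \vee v : E).
Proof. by move=> t0; rewrite !vjoin_pos -scalerBr posZ// scalerDr. Qed.

Lemma norm_pos_join_sublinear : sublinear (fun w : E * E => `|pospart (w.1 \vee w.2)|).
Proof.
split=> [[u1 u2] [v1 v2]|t [u1 u2] t0] /=; last first.
  by rewrite vjoinZ// posZ// normrZ ger0_norm.
apply: le_trans (ler_normD _ _); apply: norm_mono; first exact: pos_ge0.
apply: vle_trans (posD _ _); apply: pos_mono; apply: vjoin_lub; apply: vle_add;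
  (exact: vjoin_l || exact: vjoin_r).
Qed.

Context (KrAL :
  is_AL_space_under (Kr_AMun E F) (@op_le R E F) (@AMun_norm R E F)).

Lemma AL_under_op_norm (S T : E -> F) : Kpos_AMun E F S -> Kpos_AMun E F T ->
  op_norm (S + T) = op_norm S + op_norm T.
Proof.
move=> KS KT; have [X [iota [_ iota_range iota_le iota_norm XAL]]] := KrAL.
have lift_pos U : Kpos_AMun E F U -> exists2 a : X, iota a = U & 0 <=v a.
  move=> KU; have : range iota U by rewrite iota_range; exact: Kpos_Kr_AMun.
  by move=> [a _ aU]; exists a => //; apply/iota_le; rewrite linear0 aU; exact: KU.2.
have [a aS a0] := lift_pos S KS; have [b bT b0] := lift_pos T KT.
rewrite -!AMun_norm_pos//; last exact: Kpos_AMunD.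
by rewrite -aS -bT -linearD -!iota_norm; exact: XAL.
Qed.

(** [y |-> phi (.) y], for a positive functional [phi] of norm one, embeds [F]
    isometrically. *)
Lemma AL_under_codomain : (exists x : E, x != 0) -> is_AL_space F.
Proof.
move=> [x x0] y1 y2 y10 y20; pose z := modulus x.
have nz0 : 0 < `|z| by rewrite norm_modulus normr_gt0.
have [phi [phiD phiZ phi_le phiz]] := hahn_banach z norm_pos_sublinear.
have Pphi : positive_contraction phi by [].
have norm_eq y : 0 <=v y -> op_norm (rank_one phi y) = `|y|.
  move=> y0; apply/eqP; rewrite eq_le; apply/andP; split.
    apply: op_norm_le => u u1; apply: le_trans (rank_one_le Pphi y u) _.
    by rewrite -[leRHS]mulr1 ler_wpM2l.
  have /Kpos_AMunP[lT bT _ _] := rank_one_Kpos Pphi y0.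
  rewrite -(ler_pM2r nz0); apply: le_trans (op_norm_bound z lT bT).
  rewrite normrZ mulrC phiz pos_id; last exact: modulus_ge0.
  by rewrite normr_id.
rewrite -!norm_eq//; last exact: vadd_ge0.
rewrite -AL_under_op_norm; [|exact: rank_one_Kpos|exact: rank_one_Kpos].
by congr op_norm; apply/funext => u; rewrite /rank_one !fctE scalerDr.
Qed.

(** A functional on [E * E] below [|(u \/ v)^+|] and equal to it at [(x, y)]
    splits as a pair of positive functionals whose sum is a contraction; for the
    rank one operators built on them the additivity of the norm turns
    [|x \/ y| = phi1 x + phi2 y] into a bound by [max(|x|, |y|)]. *)
Lemma AL_under_domain : (exists y : F, y != 0) -> is_AM_space E.
Proof.
move=> [y0 ny0] x y x0 y0'; pose e := modulus y0.
have e0 : 0 <=v e by exact: modulus_ge0.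
have ne0 : 0 < `|e| by rewrite norm_modulus normr_gt0.
have j0 : 0 <=v x \vee y by apply: vle_trans x0 (vjoin_l _ _).
apply/eqP; rewrite eq_le; apply/andP; split; last first.
  by rewrite ge_max; apply/andP; split; apply: norm_mono => //; [exact: vjoin_l|exact: vjoin_r].
have [f [fD fZ f_le fxy]] := hahn_banach (x, y) norm_pos_join_sublinear.
pose phi1 u := f (u, 0); pose phi2 u := f (0, u).
have pairD (u1 u2 v1 v2 : E) : (u1 + v1, u2 + v2) = (u1, u2) + (v1, v2) by [].
have P1 : positive_contraction phi1.
  split=> [u v|t u|u]; first by rewrite /phi1 -fD -pairD addr0.
    by rewrite /phi1 -fZ -[t *: (u, 0)]/(t *: u, t *: 0) scaler0.
  apply: le_trans (f_le _) _ => /=.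
  by rewrite -/(pospart u) [pospart (pospart u)]pos_id//; exact: pos_ge0.
have vjoinC0 (u : E) : 0 \vee u = pospart u.
  by apply: vle_anti; apply: vjoin_lub; (exact: vjoin_l || exact: vjoin_r).
have P2 : positive_contraction phi2.
  split=> [u v|t u|u]; first by rewrite /phi2 -fD -pairD addr0.
    by rewrite /phi2 -fZ -[t *: (0, u)]/(t *: 0, t *: u) scaler0.
  apply: le_trans (f_le _) _ => /=.
  by rewrite vjoinC0 [pospart (pospart u)]pos_id//; exact: pos_ge0.
have f12 u v : f (u, v) = phi1 u + phi2 v by rewrite -fD -pairD addr0 add0r.
have P12 : positive_contraction (fun u => phi1 u + phi2 u).
  have [D1 Z1 _] := P1; have [D2 Z2 _] := P2.
  split=> [u v|t u|u]; first by rewrite D1 D2 addrACA.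
    by rewrite Z1 Z2 mulrDr.
  rewrite -f12; apply: le_trans (f_le _) _ => /=.
  have -> // : u \vee u = u.
  by apply: vle_anti; [apply: vjoin_lub; exact: vle_refl|exact: vjoin_l].
pose T1 := rank_one phi1 e; pose T2 := rank_one phi2 e.
have K1 : Kpos_AMun E F T1 by exact: rank_one_Kpos.
have K2 : Kpos_AMun E F T2 by exact: rank_one_Kpos.
have T12 : op_norm T1 + op_norm T2 <= `|e|.
  rewrite -AL_under_op_norm//; apply: op_norm_le => u u1.
  have -> : (T1 + T2) u = rank_one (fun u => phi1 u + phi2 u) e u.
    by rewrite /rank_one scalerDl.
  by apply: le_trans (rank_one_le P12 e u) _; rewrite -[leRHS]mulr1 ler_wpM2l.
have /Kpos_AMunP[l1 b1 _ _] := K1; have /Kpos_AMunP[l2 b2 _ _] := K2.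
set M := Num.max _ _.
have nT1 : phi1 x * `|e| <= op_norm T1 * M.
  apply: (@le_trans _ _ (op_norm T1 * `|x|)); last first.
    by rewrite ler_wpM2l ?op_norm_ge0// le_max lexx.
  apply: le_trans (op_norm_bound x l1 b1); rewrite normrZ ler_wpM2r//; exact: ler_norm.
have nT2 : phi2 y * `|e| <= op_norm T2 * M.
  apply: (@le_trans _ _ (op_norm T2 * `|y|)); last first.
    by rewrite ler_wpM2l ?op_norm_ge0// le_max lexx orbT.
  apply: le_trans (op_norm_bound y l2 b2); rewrite normrZ ler_wpM2r//; exact: ler_norm.
rewrite -(ler_pM2r ne0) -(pos_id j0) -fxy f12 mulrDl.
apply: le_trans (lerD nT1 nT2) _; rewrite -mulrDl mulrC ler_wpM2l//.
by rewrite le_max normr_ge0.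
Qed.

End Converse.

Theorem theorem3p12 (R : realType) (E F : banachLatticeType R)
    (E_nontrivial : exists x : E, x != 0)
    (F_nontrivial : exists y : F, y != 0) :
  is_AL_space_under (Kr_AMun E F) (@op_le R E F) (@AMun_norm R E F) <->
  is_AM_space E /\ is_AL_space F.
Proof.
split=> [KrAL|[EAM FAL]]; last exact: Kr_AMun_is_AL_space.
by split; [exact: AL_under_domain KrAL F_nontrivial|exact: AL_under_codomain KrAL E_nontrivial].
Qed.
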